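(* Let $(X,\mu,T)$ be an ergodic measure-preserving system on a probability space (not necessarily invertible), let $m\ge0$ be an integer and let $\delta,M>0$. Let $\mathcal{L}_{\delta,M,m}$ be the class of functions and $\|\cdot\|_{U^{m+1}}$ the Gowers-Host-Kra seminorm defined in the context. Then for every $f\in L^\infty(X,\mu)$ the inequality \[ \limsup_{N\to\infty}\ \sup_{p\in\mathcal{L}_{\delta,M,m}}\left|\frac1N\sum_{n=1}^{N} e(p(n))\, f(T^nx)\right| \le \|f\|_{U^{m+1}} \] holds for $\mu$-almost every $x\in X$. Moreover, if $(X,\mu,T)$ is uniquely ergodic and $f\in C(X)$, then \[ \limsup_{N\to\infty}\ \sup_{p\in\mathcal{L}_{\delta,M,m}}\left\|\frac1N\sum_{n=1}^{N} e(p(n))\, f\circ T^n\right\|_{\infty} \le \|f\|_{U^{m+1}} . \]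
   Context: Notation: $e(t):=e^{2\pi i t}$, and $Tf:=f\circ T$. In the ''moreover'' part, ''uniquely ergodic'' means that $X$ is a compact metric space, $T:X\to X$ is continuous and $\mu$ is the unique $T$-invariant Borel probability measure; $\|\cdot\|_\infty$ is the supremum norm. Hardy fields: call two real-valued functions of a real variable $s$, each continuous for all large $s$, equivalent if they coincide for all large $s$; the equivalence classes are called germs, and they form a ring $B$. A Hardy field is a subfield of $B$ that is closed under differentiation. $\mathcal{U}$ denotes the union of all Hardy fields. A function $p:[1,\infty)\to\mathbb{R}$ is said to belong to $\mathcal{U}$ if its germ does. Class $\mathcal{L}_{\delta,M,m}$: the set of all functions $p\in\mathcal{U}$, defined on $[1,\infty)$, for which there is an integer $0\le k\le m$ such that the derivatives $p^{(j)}$, $0\le j\le k$, exist on $[1,\infty)$ and \[ |p^{(j)}(s)|\le M s^{k-\delta-j}\qquad\text{for all } s\ge1\text{ and } j=0,\dots,k . \] Gowers-Host-Kra (uniformity) seminorms: for $f\in L^\infty(X,\mu)$ define inductively \[ \|f\|_{U^1}:=\left|\int_X f\,d\mu\right|,\qquad \|f\|_{U^{l}}^{2^{l}}:=\limsup_{N\to\infty}\frac1N\sum_{n=1}^{N}\|T^nf\cdot\overline{f}\|_{U^{l-1}}^{2^{l-1}}\quad (l\ge2). \] *)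

(* Defs.v *)
From HB Require Import structures.
From mathcomp Require Import all_boot all_order all_algebra complex.
From mathcomp Require Import all_classical all_reals all_analysis.

Set Implicit Arguments.
Unset Strict Implicit.
Unset Printing Implicit Defensive.

Import Order.TTheory GRing.Theory Num.Theory.
Import numFieldNormedType.Exports.
Import ComplexField.Normc.

Local Open Scope classical_set_scope.
Local Open Scope ring_scope.
Local Open Scope complex_scope.

(* [measurableType] requires a distinguished point, which [metricType] lacks;
   a space carrying a probability measure is nonempty anyway. *)
#[short(type="pmetricType")]
HB.structure Definition PointedMetric (K : numDomainType) :=
  { M of Pointed M & Metric K M }.

Section hardy_fields.
Context {R : realType}.
Implicit Types (f g p : R -> R) (s : R).

Definition germ_eq f g := \forall s \near +oo, f s = g s.

(* A germ is represented by all its representatives, so a set of germs is a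
   set of functions stable under [germ_eq]. *)
Record hardy_field (H : set (R -> R)) : Prop := HardyField {
  hardy_germ : forall f g, H f -> germ_eq f g -> H g;
  hardy_continuous : forall f, H f -> \forall s \near +oo, {for s, continuous f};
  hardy_one : H (cst 1);
  hardy_sub : forall f g, H f -> H g -> H (f \- g);
  hardy_mul : forall f g, H f -> H g -> H (f \* g);
  hardy_inv : forall f, H f -> ~ germ_eq f (cst 0) ->
    exists2 g, H g & germ_eq (f \* g) (cst 1);
  hardy_derivable : forall f, H f -> \forall s \near +oo, derivable f s 1;
  hardy_derive : forall f, H f -> H (f^`())%classic
}.

Definition hardy_union : set (R -> R) :=
  [set f | exists2 H, hardy_field H & H f].

(* A function on [1, +oo[ is represented by any extension to R. Derivatives are
   those of the restriction to [1, +oo[, hence one-sided at 1. *)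
Definition ray_quotient f s : R -> R := fun t => (f t - f s) / (t - s).

Definition ray_filter s := within [set t : R | 1 <= t] (s^').

Definition ray_derivable f s := cvg (ray_quotient f s @ ray_filter s).

Definition ray_derive f : R -> R := fun s => lim (ray_quotient f s @ ray_filter s).

Definition ray_deriven (j : nat) f : R -> R := iter j ray_derive f.

Definition class_L (delta M : R) (m : nat) : set (R -> R) :=
  [set p | hardy_union p /\
    exists k : nat, [/\ (k <= m)%N,
      forall j s, (j < k)%N -> 1 <= s -> ray_derivable (ray_deriven j p) s &
      forall j s, (j <= k)%N -> 1 <= s ->
        `|ray_deriven j p s| <= M * s `^ (k%:R - delta - j%:R)]].

End hardy_fields.

Definition e {R : realType} (t : R) : R[i] :=
  cos (2 * pi * t) +i* sin (2 * pi * t).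

Definition weighted_average {R : realType} {X : Type} (T : X -> X)
    (f : X -> R[i]) (p : R -> R) (N : nat) (x : X) : R[i] :=
  N%:R^-1 * \sum_(1 <= n < N.+1) e (p n%:R) * f (iter n T x).

Definition sup_norm {R : realType} {X : Type} (f : X -> R[i]) : \bar R :=
  ereal_sup [set (normc (f x))%:E | x in [set: X]].

Section systems.
Context {R : realType} {d : measure_display} {X : measurableType d}.
Implicit Types (mu nu : probability X R) (T : X -> X) (f : X -> R[i]).

Definition measure_preserving mu T :=
  measurable_fun [set: X] T /\
  forall A : set X, measurable A -> mu (T @^-1` A) = mu A.

Definition ergodic mu T :=
  measure_preserving mu T /\
  forall A : set X, measurable A -> T @^-1` A = A -> mu A = 0%E \/ mu A = 1%E.

Definition unique_invariant_probability mu T :=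
  measure_preserving mu T /\
  forall nu, measure_preserving nu T ->
    forall A : set X, measurable A -> nu A = mu A.

Definition complex_Linfty mu f :=
  (fun x => complex.Re (f x)) \in Lfun mu +oo%E /\ (fun x => complex.Im (f x)) \in Lfun mu +oo%E.

Definition complex_integral mu f : R[i] :=
  (\int[mu]_x complex.Re (f x)) +i* (\int[mu]_x complex.Im (f x)).

(* Extended-real valued only so that the limsup is total. The value at l = 0
   is a dummy: the seminorms are defined for l >= 1. *)
Fixpoint uniformity_seminorm mu T (l : nat) f : \bar R :=
  match l with
  | 0 => 0%E
  | 1 => (normc (complex_integral mu f))%:E
  | l'.+1 =>
    (limn_esup (fun N : nat =>
        (N%:R^-1)%:E * \sum_(1 <= n < N.+1)
          (uniformity_seminorm mu T l'
             (fun x => f (iter n T x) * (f x)^*%C)%R) ^+ (2 ^ l')%N)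
       `^ ((2 ^ l)%N%:R^-1)%R)%E
  end.

End systems.

(* Main.v *)
(** Van der Corput's inequality bounds the square of an average of
[u n = e (a n) * f (T^n x)] by the double average over [j, k < H] of the
correlations of [u] at lag [`|j - k|]. The correlation at lag [h] is again a
twisted average: the weight has phase [a (n + h) - a n] and the function is
[f \o T^h * f^*], so that the recursion matches the one defining the seminorms,
Jensen's inequality accounting for the exponents. Only one feature of the class
of phases survives this recursion, and it suffices: the [m]-th finite
differences tend to zero uniformly over the class, by the mean value theorem.
After [m] steps the weights tend to [1] uniformly, and the statement becomes an ergodic theorem without weights. In the
ergodic case this is Birkhoff's theorem, deduced from Garsia's maximal
inequality. In the uniquely ergodic case it is the uniform convergence of the
averages of continuous functions: an ultrafilter limit of visit frequencies
along a sequence of bad orbits is a finitely additive invariant content, which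
induces an invariant Borel measure dominating it on closed sets; that measure
must be [mu]. *)

Require Import Defs.
From HB Require Import structures.
From mathcomp Require Import all_boot all_order all_algebra complex.
From mathcomp Require Import all_classical all_reals all_analysis.
From mathcomp Require Import ess_sup_inf measurable_realfun.
From mathcomp Require Import lra ring zify.

Set Implicit Arguments.
Unset Strict Implicit.
Unset Printing Implicit Defensive.

Import Order.TTheory GRing.Theory Num.Theory.
Import numFieldNormedType.Exports.
Import ComplexField.Normc.

Local Open Scope classical_set_scope.
Local Open Scope ring_scope.

(** * Van der Corput's inequality *)

Section complex_sums.
Context {R : realType}.
Implicit Types (z w : R[i]) (u : nat -> R[i]).

Lemma normc_ge0 z : 0 <= normc z.
Proof. by case: z => a b; exact: sqrtr_ge0. Qed.

Lemma normc_conj z : normc z^*%C = normc z.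
Proof. by case: z => a b /=; rewrite sqrrN. Qed.

Lemma normc_triangle z w : normc (z + w) <= normc z + normc w.
Proof. exact: le_normcD. Qed.

Lemma normc_sum (I : Type) (r : seq I) (P : pred I) (F : I -> R[i]) :
  normc (\sum_(i <- r | P i) F i) <= \sum_(i <- r | P i) normc (F i).
Proof.
elim/big_ind2 : _ => [|z x w y zx wy|//]; first by rewrite normc0.
by rewrite (le_trans (normc_triangle _ _))// lerD.
Qed.

Lemma normc_sqr z : ((normc z) ^+ 2)%:C%C = z * z^*%C.
Proof. by rewrite -sqr_normc rmorphXn /=; case: z. Qed.

Lemma normc_nat n : normc (n%:R : R[i]) = n%:R.
Proof. by rewrite normcMn normc1. Qed.

Lemma normc_real (x : R) : normc (x%:C)%C = `|x|.
Proof. by rewrite /= expr0n addr0 sqrtr_sqr. Qed.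

(** Cauchy-Schwarz against the constant [1], by Lagrange's identity: the defect is half the double
    sum of the squares [(a i - a j) ^+ 2]. *)
Lemma sqr_sum_le (I : Type) (r : seq I) (a : I -> R) :
  (\sum_(i <- r) a i) ^+ 2 <= (size r)%:R * \sum_(i <- r) a i ^+ 2.
Proof.
rewrite -subr_ge0.
have const (x : R) : \sum_(i <- r) x = (size r)%:R * x.
  by rewrite big_const_seq count_predT iter_addr_0 mulr_natl.
have -> : (size r)%:R * \sum_(i <- r) a i ^+ 2 - (\sum_(i <- r) a i) ^+ 2 =
  2^-1 * \sum_(i <- r) \sum_(j <- r) (a i - a j) ^+ 2.
  set A := \sum_(_ <- _) _ ^+ 2; set B := \sum_(_ <- _) a _.
  have -> : \sum_(i <- r) \sum_(j <- r) (a i - a j) ^+ 2 =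
      \sum_(i <- r) ((size r)%:R * a i ^+ 2 - 2 * B * a i + A).
    apply: eq_bigr => i _.
    under eq_bigr do rewrite sqrrB -mulr_natl mulrA.
    by rewrite big_split sumrB/= const -mulr_sumr -/A -/B; ring.
  by rewrite big_split sumrB/= -!mulr_sumr -/A -/B const; field.
rewrite mulr_ge0 ?invr_ge0//.
by apply: sumr_ge0 => i _; apply: sumr_ge0 => j _; exact: sqr_ge0.
Qed.

Lemma normc_sub_le z w : normc z <= normc w + normc (z - w).
Proof. by rewrite -{1}(subrK w z) addrC normc_triangle. Qed.

(** Shifting by one changes the sum by its two end terms only, which costs [2 * C] per unit of
    shift. *)
Lemma normc_sum_shift u (C : R) (N j : nat) : (forall n, normc (u n) <= C) ->
  normc (\sum_(1 <= n < N.+1) u (n + j)%N - \sum_(1 <= n < N.+1) u n)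
    <= (2 * j)%:R * C.
Proof.
move=> uC; elim: j => [|j ih].
  by under eq_bigr do rewrite addn0; rewrite subrr normc0 mul0r.
rewrite -(subrKA (\sum_(1 <= n < N.+1) u (n + j)%N)).
rewrite (le_trans (normc_triangle _ _))//.
rewrite mulnS natrD mulrDl lerD//.
rewrite -sumrB (telescope_sumr_eq (fun n => u (n + j)%N))//; last first.
  by move=> k _; rewrite addnS -addSn.
by rewrite (le_trans (normc_triangle _ _))// normcN mulr2n mulrDl mul1r lerD.
Qed.

(* [W] is the norm of the sum over [n <= N] of the [H]-step sums of [u] from [n],
   which the Cauchy-Schwarz inequality controls. *)
Lemma van_der_corput u (C : R) (N H : nat) : (0 <= C) ->
  (forall n, normc (u n) <= C) ->
  exists2 W : R, 0 <= W &
  H%:R * normc (\sum_(1 <= n < N.+1) u n) <= W + (2 * H * H)%:R * C /\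
  W ^+ 2 <= N%:R * (\sum_(j < H) \sum_(k < H)
     (normc (\sum_(1 <= n < N.+1) u (n + `|j - k|)%N * (u n)^*%C) + (2 * H)%:R * C ^+ 2)).
Proof.
move=> C0 uC.
exists (normc (\sum_(1 <= n < N.+1) \sum_(j < H) u (n + j)%N)); first exact: normc_ge0.
split.
  rewrite -[X in X * _](normc_nat H) -normcM.
  rewrite (le_trans (normc_sub_le _ (\sum_(1 <= n < N.+1) \sum_(j < H) u (n + j)%N)))//.
  rewrite lerD2l exchange_big/=.
  have -> : H%:R * \sum_(1 <= n < N.+1) u n = \sum_(j < H) \sum_(1 <= n < N.+1) u n.
    by rewrite sumr_const card_ord mulr_natl.
  rewrite -sumrB.
  rewrite (le_trans (normc_sum _ _ _))//.
  rewrite (@le_trans _ _ (\sum_(j < H) (2 * H)%:R * C))//; last first.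
    by rewrite sumr_const card_ord -[leLHS]mulr_natl mulrA -natrM [(H * _)%N]mulnC.
  apply: ler_sum => j _; rewrite -normcN opprB.
  rewrite (le_trans (normc_sum_shift N j uC))// ler_wpM2r// ler_nat.
  by rewrite leq_mul2l ltnW// ltn_ord orbT.
rewrite (@le_trans _ _ ((\sum_(1 <= n < N.+1) normc (\sum_(j < H) u (n + j)%N)) ^+ 2))//.
  by rewrite lerXn2r ?nnegrE ?normc_ge0 ?normc_sum ?sumr_ge0// => *; exact: normc_ge0.
rewrite (le_trans (sqr_sum_le _ _))// size_iota subn1 ler_wpM2l//.
(* Each squared norm is expanded as [z * z^*] and the sum over [n] is moved inside. *)
have E : ((\sum_(1 <= n < N.+1) normc (\sum_(j < H) u (n + j)%N) ^+ 2)%:C)%C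
   = \sum_(j < H) \sum_(k < H) \sum_(1 <= n < N.+1) u (n + j)%N * (u (n + k)%N)^*%C.
  rewrite rmorph_sum/=; under eq_bigr do rewrite normc_sqr rmorph_sum big_distrlr/=.
  by rewrite exchange_big/=; apply: eq_bigr => j _; rewrite exchange_big.
rewrite -[X in X <= _]ger0_norm; last by apply: sumr_ge0 => n _; exact: sqr_ge0.
rewrite -normc_real {}E.
rewrite (le_trans (normc_sum _ _ _))//; apply: ler_sum => j _.
rewrite (le_trans (normc_sum _ _ _))//; apply: ler_sum => k _.
(* Exchanging [j] and [k] conjugates the correlation, which preserves its norm. *)
wlog jk : j k / (k <= j)%N => [hw|].
  have [kj|jk] := leqP k j; first exact: hw.
  rewrite distnC -normc_conj rmorph_sum/=.
  under eq_bigr do rewrite rmorphM/= conjcK mulrC.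
  exact/hw/ltnW.
rewrite distnEl//.
(* The summand is the correlation at lag [j - k] shifted by [k], so [normc_sum_shift] applies with
   the bound [C ^+ 2]. *)
set v := fun n => u (n + (j - k))%N * (u n)^*%C.
have vC n : normc (v n) <= C ^+ 2.
  by rewrite normcM normc_conj expr2 ler_pM ?normc_ge0.
rewrite (le_trans (normc_sub_le _ (\sum_(1 <= n < N.+1) v n)))// lerD2l.
under eq_bigr => n _.
  rewrite (_ : _ * _ = v (n + k)%N); last by rewrite /v -addnA subnKC.
  over.
rewrite (le_trans (normc_sum_shift N k vC))// ler_wpM2r ?sqr_ge0// ler_nat.
by rewrite leq_mul2l ltnW// ltn_ord orbT.
Qed.

End complex_sums.

Section averages.
Context {R : realType}.

(** Jensen's inequality for the power [2 ^ m], obtained by applying Cauchy-Schwarz [m] times. *)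
Lemma power_mean_le (I : Type) (r : seq I) (m : nat) (a : I -> R) :
  (0 < size r)%N -> (forall i, 0 <= a i) ->
  ((size r)%:R^-1 * \sum_(i <- r) a i) ^+ (2 ^ m)
    <= (size r)%:R^-1 * \sum_(i <- r) a i ^+ (2 ^ m).
Proof.
move=> r0; have r0' : 0 < (size r)%:R :> R by rewrite ltr0n.
elim: m a => [|m ih] a a0; first by rewrite expr1.
rewrite expnS exprM; under [in leRHS]eq_bigr do rewrite exprM.
apply: le_trans (ih _ (fun i => sqr_ge0 (a i))).
rewrite lerXn2r ?nnegrE ?sqr_ge0//.
  by rewrite mulr_ge0 ?invr_ge0// sumr_ge0// => i _; exact: sqr_ge0.
rewrite exprMn expr2 -mulrA ler_pM2l ?invr_gt0//.
by rewrite ler_pdivrMl// sqr_sum_le.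
Qed.

(* The double average is a Fejer mean of the Cesaro averages of [d]. *)
Lemma double_average_le (d : nat -> R) (K B : R) : (forall h, 0 <= d h) ->
  (\forall n \near \oo, \sum_(1 <= h < n.+1) d h <= K * n%:R) -> K < B ->
  exists2 H : nat, (0 < H)%N &
    \sum_(j < H) \sum_(k < H) d `|j - k|%N < B * H%:R ^+ 2.
Proof.
move=> d0 [n0 _ dK] KB.
have P0 n : 0 <= \sum_(1 <= h < n.+1) d h by apply: sumr_ge0.
have K0 : 0 <= K.
  have := le_trans (P0 _) (dK n0.+1 (leqnSn _)).
  by rewrite pmulr_lge0// ltr0n.
set K0' := \sum_(1 <= h < n0.+1) d h.
(* The constant [K0'] absorbs the indices below [n0], where the hypothesis gives no bound. *)
have PK n : \sum_(1 <= h < n.+1) d h <= K0' + K * n%:R.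
  have [nn0|/ltnW nn0] := leqP n0 n.
    by rewrite (le_trans (dK _ nn0))// lerDr; exact: P0.
  rewrite (@le_trans _ _ K0')//; last by rewrite lerDl mulr_ge0.
  by rewrite /K0' (@big_cat_nat _ _ _ n.+1 1 n0.+1)//= lerDl; exact: sumr_ge0.
(* Passing from [H] to [H.+1] adds the diagonal term [d 0] and a row and a column, each of sum at
   most [K0' + K * H%:R]. *)
have D H : \sum_(j < H) \sum_(k < H) d `|j - k|%N <=
    H%:R * (d 0%N + 2 * K0') + K * H%:R ^+ 2.
  elim: H => [|H ih]; first by rewrite big_ord0 mul0r add0r expr0n mulr0.
  rewrite big_ord_recr/= big_ord_recr/= distnn.
  under eq_bigr do rewrite big_ord_recr/=.
  rewrite big_split/=.
  have E : \sum_(i < H) d `|H - i|%N = \sum_(1 <= h < H.+1) d h.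
    rewrite big_add1 big_mkord (reindex_inj rev_ord_inj)/=; apply: eq_bigr => i _.
    by congr d; rewrite distnEl ?leq_subr// subKn.
  under [X in _ + X + _]eq_bigr do rewrite distnC.
  rewrite E -natr1.
  have := PK H; move: ih; nra.
(* Beyond this size the linear term of [D] is smaller than [(B - K) * H%:R ^+ 2]. *)
set n1 := Num.bound ((d 0%N + 2 * K0') / (B - K)).
exists n1.+1 => //; apply: (le_lt_trans (D _)).
have /archi_boundP : 0 <= (d 0%N + 2 * K0') / (B - K).
  by rewrite divr_ge0 ?subr_ge0 ?(ltW KB)// addr_ge0// mulr_ge0//; exact: P0.
rewrite -/n1 ltr_pdivrMr ?subr_gt0//.
have : 0 <= n1%:R :> R by [].
rewrite -natr1; nra.
Qed.

(** Jensen's inequality over the [H ^ 2] pairs [(j, k)] turns a bound on averaged powers into one on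
    the averages themselves. *)
Lemma double_average_root (c : nat -> R) (m : nat) (K B : R) :
  (forall h, 0 <= c h) -> 0 <= B ->
  (\forall n \near \oo, \sum_(1 <= h < n.+1) c h ^+ (2 ^ m) <= K * n%:R) ->
  K < B ^+ (2 ^ m) ->
  exists2 H : nat, (0 < H)%N &
    \sum_(j < H) \sum_(k < H) c `|j - k|%N < B * H%:R ^+ 2.
Proof.
move=> c0 B0 cK KB.
have [H H0 HB] := double_average_le (fun h => exprn_ge0 _ (c0 h)) cK KB.
exists H => //.
have H2 : 0 < H%:R ^+ 2 :> R by rewrite exprn_gt0// ltr0n.
have sz : size (index_enum ('I_H * 'I_H)%type) = (H ^ 2)%N.
  by rewrite -[index_enum _]enumT -cardT card_prod card_ord.
rewrite -ltr_pdivrMr//.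
rewrite -(@ltr_pXn2r _ (2 ^ m)) ?expn_gt0 ?nnegrE//; last first.
  by rewrite divr_ge0 ?sqr_ge0// sumr_ge0// => j _; rewrite sumr_ge0.
have := @power_mean_le _ (index_enum ('I_H * 'I_H)%type) m
  (fun p => c `|p.1 - p.2|%N).
rewrite sz expn_gt0 H0 natrX => /(_ isT (fun=> c0 _)).
rewrite mulrC pair_big/= => /le_lt_trans; apply.
by move: HB; rewrite pair_big/= ltr_pdivrMl// mulrC.
Qed.

Lemma ord_dist_lt (n : nat) (j k : 'I_n) : (`|j - k| < n)%N.
Proof. by have := ltn_ord j; have := ltn_ord k; lia. Qed.

(** The lags stay below an [H] fixed before [N] grows, so finitely many correlation bounds suffice
    and the threshold for [N] is uniform in [i]. The boundary terms of [van_der_corput] are of lower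
    order in [N]. *)
Lemma van_der_corput_limsup (I : Type) (u : I -> nat -> R[i]) (C K B : R)
    (c : nat -> R) (m : nat) :
  0 <= C -> (forall i n, normc (u i n) <= C) -> (forall h, 0 <= c h) -> 0 < B ->
  (forall h b, c h < b -> \forall N \near \oo, forall i,
     normc (\sum_(1 <= n < N.+1) u i (n + h)%N * (u i n)^*%C) <= b * N%:R) ->
  (\forall n \near \oo, \sum_(1 <= h < n.+1) c h ^+ (2 ^ m) <= K * n%:R) ->
  K < (B ^+ 2) ^+ (2 ^ m) ->
  \forall N \near \oo, forall i, normc (\sum_(1 <= n < N.+1) u i n) <= B * N%:R.
Proof.
move=> C0 uC c0 B0 ub cK KB.
have [H H0 HB] := double_average_root c0 (sqr_ge0 B) cK KB.
have H0' : 0 < H%:R :> R by rewrite ltr0n.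
set q := \sum_(j < H) _ in HB.
have q0 : 0 <= q by rewrite /q sumr_ge0// => j _; rewrite sumr_ge0.
(* [B1 ^+ 2] is the midpoint of [q / H%:R ^+ 2] and [B ^+ 2]: the gap below it pays for the bound on
   [W], the gap above it for the boundary term added to [W]. *)
pose B1 := Num.sqrt ((q / H%:R ^+ 2 + B ^+ 2) / 2).
have qB : q / H%:R ^+ 2 < B ^+ 2 by rewrite ltr_pdivrMr// exprn_gt0.
have q0' : 0 <= q / H%:R ^+ 2 by rewrite divr_ge0// sqr_ge0.
have B1E : B1 ^+ 2 = (q / H%:R ^+ 2 + B ^+ 2) / 2.
  by rewrite sqr_sqrtr// divr_ge0// addr_ge0// sqr_ge0.
have B1_ge0 : 0 <= B1 by exact: sqrtr_ge0.
have B1B : B1 < B.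
  by rewrite -(@ltr_pXn2r _ 2) ?nnegrE// ?ltW// B1E; lra.
have qB1 : q < B1 ^+ 2 * H%:R ^+ 2.
  by rewrite -ltr_pdivrMr ?exprn_gt0// B1E; lra.
(* Half of the gap [B1 ^+ 2 * H%:R ^+ 2 - q] pays for replacing [c h] by [c h + eta], the other half
   for the boundary terms, through [N2]. *)
pose eta := (B1 ^+ 2 * H%:R ^+ 2 - q) / 2 / H%:R ^+ 2.
have eta0 : 0 < eta by rewrite divr_gt0 ?exprn_gt0// divr_gt0// subr_gt0.
have etaE : H%:R ^+ 2 * eta = (B1 ^+ 2 * H%:R ^+ 2 - q) / 2.
  by rewrite /eta mulrC divfK// gt_eqF// exprn_gt0.
have ub' : \forall N \near \oo, forall (h : 'I_H) i,
    normc (\sum_(1 <= n < N.+1) u i (n + h)%N * (u i n)^*%C) <= (c h + eta) * N%:R.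
  by apply: filter_forall => h; apply: ub; rewrite ltrDl.
near=> N.
have hub : forall (h : 'I_H) i,
    normc (\sum_(1 <= n < N.+1) u i (n + h)%N * (u i n)^*%C) <= (c h + eta) * N%:R.
  by near: N.
move=> i.
have [W W0 [SW WN]] := van_der_corput N H C0 (uC i).
have N1 : (2 * H * H)%:R * C / ((B - B1) * H%:R) <= N%:R.
  by near: N; exact: nbhs_infty_ger.
have N2 : H%:R ^+ 2 * ((2 * H)%:R * C ^+ 2) / ((B1 ^+ 2 * H%:R ^+ 2 - q) / 2) <= N%:R.
  by near: N; exact: nbhs_infty_ger.
rewrite ler_pdivrMr in N1; last by rewrite mulr_gt0// subr_gt0.
rewrite ler_pdivrMr in N2; last by rewrite divr_gt0// subr_gt0.
have WB : W <= B1 * H%:R * N%:R.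
  rewrite -(@ler_pXn2r _ 2) ?nnegrE ?mulr_ge0//.
  apply: (le_trans WN).
  have -> : (B1 * H%:R * N%:R) ^+ 2 = N%:R * (N%:R * (B1 ^+ 2 * H%:R ^+ 2)) by ring.
  rewrite ler_wpM2l//.
  apply: (@le_trans _ _ (\sum_(j < H) \sum_(k < H)
      (c `|j - k|%N * N%:R + (eta * N%:R + (2 * H)%:R * C ^+ 2)))).
    apply: ler_sum => j _; apply: ler_sum => k _.
    rewrite addrA lerD2r -mulrDl.
    exact: (hub (Ordinal (ord_dist_lt j k)) i).
  have const (x : R) : \sum_(k < H) x = H%:R * x.
    by rewrite sumr_const card_ord mulr_natl.
  under eq_bigr do rewrite big_split/= const -mulr_suml.
  rewrite big_split/= const -mulr_suml -/q.
  have -> : H%:R * (H%:R * (eta * N%:R + (2 * H)%:R * C ^+ 2)) =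
    H%:R ^+ 2 * eta * N%:R + H%:R ^+ 2 * ((2 * H)%:R * C ^+ 2) by ring.
  rewrite etaE; lra.
rewrite -(ler_pM2l H0') (le_trans SW)//.
lra.
Unshelve. all: by end_near. Qed.

End averages.

(** * Twisted averages *)

Section limn_esup_bounds.
Context {R : realType}.
Implicit Type u : (\bar R)^nat.
Local Open Scope ereal_scope.

Lemma limn_esup_lt u a : limn_esup u < a -> \forall n \near \oo, u n < a.
Proof.
move=> /ereal_inf_lt[_ [V nV <-]] Va.
apply: filterS nV => n Vn; apply: le_lt_trans Va.
by apply: ereal_sup_ubound; exists n.
Qed.

Lemma limn_esup_le u a : (\forall n \near \oo, u n <= a) -> limn_esup u <= a.
Proof.
move=> ua; apply: (@le_trans _ _ (ereal_sup [set u n | n in [set n | u n <= a]])).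
  by apply: ereal_inf_lbound; exists [set n | u n <= a].
by apply: ge_ereal_sup => _ [n + <-].
Qed.

Lemma expye n : (0 < n)%N -> (+oo ^+ n : \bar R) = +oo.
Proof.
by case: n => // n _; elim: n => // n ih; rewrite expeS ih mulyy.
Qed.

End limn_esup_bounds.

Section exponential.
Context {R : realType}.

Lemma normc_e (t : R) : normc (e t) = 1.
Proof. by rewrite /e/= cos2Dsin2 sqrtr1. Qed.

Lemma eD (s t : R) : e (s + t) = e s * e t.
Proof.
rewrite /e mulrDr cosD sinD; apply/eqP; rewrite eq_complex/=.
by apply/andP; split; apply/eqP; ring.
Qed.

Lemma e_conj (t : R) : (e t)^*%C = e (- t).
Proof. by rewrite /e mulrN cosN sinN. Qed.

Lemma conjcM (z w : R[i]) : (z * w)^*%C = z^*%C * w^*%C.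
Proof. exact: rmorphM. Qed.

Lemma normc_le_ReIm (z : R[i]) : normc z <= `|complex.Re z| + `|complex.Im z|.
Proof.
case: z => a b /=.
rewrite -[leRHS]ger0_norm ?addr_ge0// -sqrtr_sqr ler_wsqrtr// sqrrD.
rewrite !real_normK ?num_real//.
by rewrite addrAC lerDl mulrn_wge0// mulr_ge0.
Qed.

Lemma e_near0 (eta : R) : 0 < eta -> \forall t \near 0, normc (e t - 1) <= eta.
Proof.
move=> eta0.
have cvgc : cos (2 * pi * t) @[t --> (0 : R)] --> (1 : R).
  rewrite -[X in _ --> X](_ : cos (2 * pi * 0) = 1); last by rewrite mulr0 cos0.
  apply: continuous_cvg; first exact: continuous_cos.
  by apply: cvgMl_tmp; exact: cvg_id.
have cvgs : sin (2 * pi * t) @[t --> (0 : R)] --> (0 : R).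
  rewrite -[X in _ --> X](_ : sin (2 * pi * 0) = 0); last by rewrite mulr0 sin0.
  apply: continuous_cvg; first exact: continuous_sin.
  by apply: cvgMl_tmp; exact: cvg_id.
have eta2 : 0 < eta / 2 by rewrite divr_gt0.
near=> t; rewrite (le_trans (normc_le_ReIm _))// /e/= subr0 (splitr eta).
rewrite lerD//.
  by rewrite distrC; near: t; move/cvgr_dist_le: cvgc => /(_ _ eta2).
by rewrite -normrN -sub0r; near: t; move/cvgr_dist_le: cvgs => /(_ _ eta2).
Unshelve. all: by end_near. Qed.

End exponential.

Section twisted.
Context {R : realType}.
Implicit Types (a eps : nat -> R).

Definition fdiff a : nat -> R := fun n => a n.+1 - a n.

(* The bound starts at [n = 2], so that only derivatives at points [s > 1] of
   the interpolating functions matter. *)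
Definition fdiff_le (m : nat) eps : set (nat -> R) :=
  [set a | forall n, (1 < n)%N -> `|iter m fdiff a n| <= eps n].

Lemma iter_fdiffB m a b :
  iter m fdiff (fun n => a n - b n) = (fun n => iter m fdiff a n - iter m fdiff b n).
Proof.
elim: m => //= m ->; apply/funext => n; rewrite /fdiff; ring.
Qed.

Lemma iter_fdiff_shift m a h :
  iter m fdiff (fun n => a (n + h)%N) = (fun n => iter m fdiff a (n + h)%N).
Proof. by elim: m => //= m ->; apply/funext => n; rewrite /fdiff addSn. Qed.

Lemma iter_fdiff_sub m a h n :
  iter m fdiff (fun n => a (n + h)%N - a n) n = \sum_(i < h) iter m.+1 fdiff a (n + i)%N.
Proof.
rewrite iter_fdiffB iter_fdiff_shift/=.
rewrite -(big_mkord xpredT (fun i => fdiff (iter m fdiff a) (n + i)%N)).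
rewrite (telescope_sumr_eq (fun i => iter m fdiff a (n + i)%N)) ?addn0//.
by move=> i _; rewrite /fdiff addnS.
Qed.

(** The descent on phases: by telescoping, the [m]-th difference of the increment at lag [h] is a
    sum of [h] differences of order [m.+1]. *)
Lemma fdiff_le_shift m eps a h : fdiff_le m.+1 eps a ->
  fdiff_le m (fun n => \sum_(i < h) eps (n + i)%N) (fun n => a (n + h)%N - a n).
Proof.
move=> aeps n n1; rewrite iter_fdiff_sub (le_trans (ler_norm_sum _ _ _))//.
by apply: ler_sum => i _; apply: aeps; rewrite ltn_addr.
Qed.

Lemma cvg_sum_shift eps h : eps @ \oo --> (0 : R) ->
  (fun n => \sum_(i < h) eps (n + i)%N) @ \oo --> (0 : R).
Proof.
move=> eps0; elim: h => [|h ih].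
  by under eq_fun do rewrite big_ord0; exact: cvg_cst.
have -> : (fun n => \sum_(i < h.+1) eps (n + i)%N) =
    (fun n => \sum_(i < h) eps (n + i)%N) \+ (fun n => eps (n + h)%N).
  by apply/funext => n; rewrite big_ord_recr.
have eh : (fun n => eps (n + h)%N) @ \oo --> (0 : R) by rewrite (cvg_shiftn h eps).
have H := cvgD ih eh; rewrite addr0 in H.
exact: (H _).
Qed.

Context {d : measure_display} {X : measurableType d}.
(** [S] holds the points over which the bounds are uniform, and [A] is a class closed under the
    recursion. The ergodic case takes a single generic point and the functions derived from [f]; the
    uniquely ergodic case takes the whole space and the continuous functions. *)
Variables (mu : probability X R) (T : X -> X) (S : set X) (A : set (X -> R[i])).
Hypothesis A_bounded : forall f, A f ->
  exists C, forall x n, S x -> normc (f (iter n T x)) <= C.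
Hypothesis A_conj : forall f h, A f -> A (fun x => f (iter h T x) * (f x)^*%C).
Hypothesis A_average : forall f B, A f -> normc (complex_integral mu f) < B ->
  \forall N \near \oo, forall x, S x ->
    normc (\sum_(1 <= n < N.+1) f (iter n T x)) <= B * N%:R.

Local Arguments uniformity_seminorm : simpl never.

Lemma uniformity_seminorm_ge0 l f : (0 <= uniformity_seminorm mu T l f)%E.
Proof.
case: l => [//|[|l]]; last exact: poweR_ge0.
by rewrite lee_fin normc_ge0.
Qed.

Lemma uniformity_seminormSS l f :
  uniformity_seminorm mu T l.+2 f =
    ((limn_esup (fun N : nat => (N%:R^-1)%:E * \sum_(1 <= n < N.+1)
        (uniformity_seminorm mu T l.+1
             (fun x => f (iter n T x) * (f x)^*%C)%R) ^+ (2 ^ l.+1)%N)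
       `^ ((2 ^ l.+2)%N%:R^-1)%R)%E)%E.
Proof. by []. Qed.

(** The phases themselves tend to zero uniformly, so beyond an initial stretch the weights can be
    replaced by [1]. *)
Lemma twisted_average0 f eps B : A f -> eps @ \oo --> (0 : R) ->
  normc (complex_integral mu f) < B ->
  \forall N \near \oo, forall a x, fdiff_le 0 eps a -> S x ->
    normc (\sum_(1 <= n < N.+1) e (a n) * f (iter n T x)) <= B * N%:R.
Proof.
move=> Af eps0 fB; have [C0 fC0] := A_bounded Af.
pose C := Num.max C0 1; have C1 : 0 < C by rewrite lt_max ltr01 orbT.
have fC x n : S x -> normc (f (iter n T x)) <= C.
  by move=> Sx; rewrite (le_trans (fC0 _ _ Sx))// le_max lexx.
set I := normc _ in fB.
(* One third of [B - I] each goes to the unweighted sum, to the distance of the weights from [1],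
   and to the initial terms. *)
pose eta := (B - I) / 3 / C.
have BI : 0 < (B - I) / 3 by rewrite divr_gt0// subr_gt0.
have eta0 : 0 < eta by rewrite divr_gt0.
have [r /= r0 er] := e_near0 eta0.
have [n0 _ eps_r] : \forall n \near \oo, eps n < r.
  by apply: (cvgr_lt 0).
near=> N => a x aeps Sx.
have E1 : normc (\sum_(1 <= n < N.+1) f (iter n T x)) <= (I + (B - I) / 3) * N%:R.
  suff : forall x, S x ->
      normc (\sum_(1 <= n < N.+1) f (iter n T x)) <= (I + (B - I) / 3) * N%:R.
    exact.
  by near: N; apply: A_average => //; rewrite ltrDl.
have N1 : (n0 + 2)%:R * (2 * C) / ((B - I) / 3) <= N%:R.
  by near: N; exact: nbhs_infty_ger.
rewrite ler_pdivrMr// in N1.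
have nN : (n0 + 2 <= N.+1)%N.
  by apply: leqW; near: N; exact: nbhs_infty_ge.
rewrite (le_trans (normc_sub_le _ (\sum_(1 <= n < N.+1) f (iter n T x))))//.
suff E2 : normc (\sum_(1 <= n < N.+1) e (a n) * f (iter n T x) -
    \sum_(1 <= n < N.+1) f (iter n T x)) <= (n0 + 2)%:R * (2 * C) + eta * C * N%:R.
  rewrite (le_trans (lerD E1 E2))//.
  have -> : eta * C = (B - I) / 3 by rewrite /eta divfK// gt_eqF.
  by nra.
rewrite -sumrB (le_trans (normc_sum _ _ _))//.
(* The cutoff lies beyond [n0] and beyond the index [1], where [fdiff_le] gives no bound. *)
rewrite (@big_cat_nat _ _ _ (n0 + 2)%N)//=; last by rewrite addn2.
have term n : normc (e (a n) * f (iter n T x) - f (iter n T x)) =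
    normc (e (a n) - 1) * normc (f (iter n T x)).
  by rewrite -normcM mulrBl mul1r.
rewrite lerD//.
  rewrite (@le_trans _ _ (\sum_(1 <= n < (n0 + 2)%N) 2 * C))//; last first.
    rewrite sumr_const_nat -[leLHS]mulr_natl ler_wpM2r ?mulr_ge0 ?(ltW C1)//.
    by rewrite ler_nat leq_subr.
  apply: ler_sum => n _; rewrite term ler_pM ?normc_ge0 ?fC//.
  by rewrite (le_trans (normc_triangle _ _))// normcN normc1 normc_e.
rewrite (@le_trans _ _ (\sum_((n0 + 2)%N <= n < N.+1) eta * C))//; last first.
  rewrite sumr_const_nat -[leLHS]mulr_natr ler_wpM2l ?(mulr_ge0 (ltW eta0) (ltW C1))//.
  by rewrite ler_nat; lia.
rewrite big_nat [leRHS]big_nat.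
apply: ler_sum => n /andP[n0n _]; rewrite term ler_pM ?normc_ge0 ?fC//.
apply: er; rewrite /= sub0r normrN (le_lt_trans (aeps n _))//; first lia.
by apply: eps_r => /=; lia.
Unshelve. all: by end_near. Qed.

(** Uniformity over the phases is part of the induction: at lag [h] the hypothesis is applied to all
    the increments [a (n + h) - a n] at once, with the common bound of [fdiff_le_shift]. *)
Lemma twisted_average m f eps B : A f -> eps @ \oo --> (0 : R) ->
  (uniformity_seminorm mu T m.+1 f < B%:E)%E ->
  \forall N \near \oo, forall a x, fdiff_le m eps a -> S x ->
    normc (\sum_(1 <= n < N.+1) e (a n) * f (iter n T x)) <= B * N%:R.
Proof.
elim: m f eps B => [|m ih] f eps B Af eps0.
  by move=> fB; apply: twisted_average0 => //; rewrite -lte_fin.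
have B0 : (uniformity_seminorm mu T m.+2 f < B%:E)%E -> 0 < B.
  by move=> /(le_lt_trans (uniformity_seminorm_ge0 _ _)); rewrite lte_fin.
move=> fB; have {B0} B0 := B0 fB; move: fB.
rewrite uniformity_seminormSS.
pose s h := uniformity_seminorm mu T m.+1 (fun x => (f (iter h T x) * (f x)^*%C)%R).
set v := limn_esup _ => vB.
have {vB} : (v < (B ^+ (2 ^ m.+2))%:E)%E.
  (* Roots are monotone: a limsup of at least [B ^+ (2 ^ m.+2)] would push the seminorm up to
     [B]. *)
  rewrite ltNge; apply/negP => Bv; move: vB; rewrite ltNge => /negP; apply.
  have -> : B%:E = ((B ^+ (2 ^ m.+2))%:E `^ ((2 ^ m.+2)%N%:R^-1))%E.
    rewrite poweR_EFin -powR_mulrn ?ltW// -powRrM divff ?pnatr_eq0 ?expn_eq0//.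
    by rewrite powRr1// ltW.
  have P0 : 0 <= B ^+ (2 ^ m.+2) by rewrite exprn_ge0// ltW.
  apply: gt0_ler_poweR => //; first by rewrite in_itv/= lee_fin P0 leey.
  by rewrite in_itv/= leey andbT (le_trans _ Bv)// lee_fin.
move=> vB; have {vB} [K vK KB] : exists2 K : R, (v < K%:E)%E & K < B ^+ (2 ^ m.+2).
  have v0 : (0 <= v)%E.
    rewrite /v limn_esup_lim; apply: lime_ge; first exact: is_cvg_esups.
    apply: nearW => n; apply: le_trans (ereal_sup_ubound _); last by exists n => /=.
    rewrite mule_ge0// ?lee_fin//; apply: sume_ge0 => k _.
    by apply: expe_ge0; exact: uniformity_seminorm_ge0.
  move: v0 vB; case: v => [r| |//]; last by [].
  rewrite lte_fin => r0 rB; exists ((r + B ^+ (2 ^ m.+2)) / 2); rewrite ?lte_fin; lra.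
have {vK} [n0 _ vK] := limn_esup_lt vK.
have s_ge0 h : (0 <= s h)%E by exact: uniformity_seminorm_ge0.
(* One infinite seminorm would make all later averages infinite, but these are eventually below
   [K]. *)
have s_fin h : (0 < h)%N -> s h \is a fin_num.
  move=> h0; rewrite ge0_fin_numE// ltNge leye_eq; apply/negP => /eqP sh.
  have := vK (n0 + h)%N (leq_addr _ _).
  have hn : (0 < n0 + h)%N by rewrite addn_gt0 h0 orbT.
  rewrite (bigD1_seq h) ?iota_uniq//=; last first.
    by rewrite mem_index_iota h0 ltnS leq_addl.
  rewrite -/(s h) sh expye ?expn_gt0// addye; last first.
    rewrite gt_eqF// (lt_le_trans ltNy0)//; apply: sume_ge0 => k _.
    by apply: expe_ge0; exact: s_ge0.
  by rewrite gt0_muley ?lte_fin ?invr_gt0 ?ltr0n.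
have [C0 fC0] := A_bounded Af.
pose C := Num.max C0 0; have C_ge0 : 0 <= C by rewrite le_max lexx orbT.
have fC x n : S x -> normc (f (iter n T x)) <= C.
  by move=> Sx; rewrite (le_trans (fC0 _ _ Sx))// le_max lexx.
(* At lag zero the correlation is bounded through [C ^+ 2]; [cK] concerns the lags from one on,
   where [c] is the seminorm. *)
pose c h := if h is 0%N then C ^+ 2 else fine (s h).
have c_ge0 h : 0 <= c h by case: h => [|h] /=; [rewrite sqr_ge0|rewrite fine_ge0].
have cK : \forall n \near \oo, \sum_(1 <= h < n.+1) c h ^+ (2 ^ m.+1) <= K * n%:R.
  exists n0.+1 => // n /= n0n.
  have n_gt0 : 0 < n%:R :> R by rewrite ltr0n (leq_trans _ n0n).
  have := ltW (vK n (ltnW n0n)).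
  rewrite (_ : \sum_(1 <= k < n.+1) _ = (\sum_(1 <= h < n.+1) c h ^+ (2 ^ m.+1))%:E)%E.
    by rewrite -EFinM lee_fin ler_pdivrMl// mulrC.
  rewrite -sumEFin big_nat [RHS]big_nat; apply: eq_bigr => -[//|k] _.
  by rewrite EFin_expe /c fineK// s_fin.
(* Indexing by pairs of an admissible phase and a point of [S] turns the uniformity in [i] into
   uniformity over both. *)
pose I := {ax : (nat -> R) * X | fdiff_le m.+1 eps ax.1 /\ S ax.2}.
pose u (i : I) n := e ((sval i).1 n) * f (iter n T (sval i).2).
have uC i n : normc (u i n) <= C.
  by rewrite /u normcM normc_e mul1r; apply: fC; case: i => ? [].
suff : \forall N \near \oo, forall i, normc (\sum_(1 <= n < N.+1) u i n) <= B * N%:R.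
  by apply: filterS => N uN a x aeps Sx; exact: (uN (exist _ (a, x) (conj aeps Sx))).
apply: (@van_der_corput_limsup _ _ u C K B c m.+1) => //; last first.
  by rewrite -exprM -expnS.
move=> [|h] b.
  move=> /ltW C2b; apply: nearW => N i.
  rewrite (le_trans (normc_sum _ _ _))//.
  rewrite (@le_trans _ _ (\sum_(1 <= n < N.+1) b))//; last first.
    by rewrite sumr_const_nat subn1 mulr_natr.
  apply: ler_sum => n _; rewrite addn0 normcM normc_conj (@le_trans _ _ (C ^+ 2))//.
  by rewrite expr2 ler_pM ?normc_ge0.
move=> cb; have sb : (s h.+1 < b%:E)%E by rewrite -(fineK (s_fin h.+1 isT)) lte_fin.
have := ih _ _ _ (A_conj h.+1 Af) (cvg_sum_shift h.+1 eps0) sb.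
apply: filterS => N bN [[a x] [/= aeps Sx]].
have := bN _ _ (fdiff_le_shift h.+1 aeps) Sx.
congr (normc _ <= _); apply: eq_bigr => n _.
by rewrite /u/= -iterS conjcM e_conj eD addnC iterD; ring.
Qed.

End twisted.

(** * Finite differences of the phases *)

Section finite_differences.
Context {R : realType}.
Implicit Types (p f : R -> R) (G : nat -> R -> R).

(** Points close to some [s > 1] all lie on the ray, so the restriction in the filter disappears. *)
Lemma ray_is_derive f s : 1 < s -> ray_derivable f s ->
  is_derive s 1 f (ray_derive f s).
Proof.
move=> s1 fs.
have : ray_quotient f s @ ray_filter s --> ray_derive f s by [].
set l := ray_derive f s => fl.
have H : h^-1 *: (f (h *: 1 + s) - f s) @[h --> (0 : R)^'] --> l.
  apply/cvgrPdist_le => eps eps0; move/cvgrPdist_le : fl => /(_ eps eps0).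
  rewrite /ray_filter /prop_near1 /within /dnbhs /= /nbhs/= => -[r /= r0 rl].
  exists (Num.min r (s - 1)) => /=; first by rewrite lt_min r0 subr_gt0.
  move=> h /=; rewrite sub0r normrN lt_min => /andP[hr hs] h0.
  have hs' := ltr_normlW hs.
  have := rl (h *: 1 + s); rewrite /ball/= /ray_quotient.
  rewrite -[h *: 1]/(h * 1) mulr1 addrK opprD addrCA subrr addr0 normrN mulrC.
  apply => //.
    by rewrite -subr_eq0 addrK.
  move: hs; rewrite ltr_norml => /andP[+ _]; lra.
split; first by apply/cvg_ex; exists l.
exact/cvg_lim.
Qed.

Definition rdiff f : R -> R := fun s => f (s + 1) - f s.

Lemma iter_fdiff_nat k p n :
  iter k fdiff (fun n => p n%:R) n = iter k rdiff p n%:R.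
Proof.
elim: k n => //= k ih n.
by rewrite /fdiff !ih /rdiff natr1.
Qed.

(** [G] lists successive derivatives. The mean value theorem bounds a unit difference of [G k] by a
    value of [G k.+1] further right, and the functions [rdiff (G j)] again form a chain of
    derivatives, one step shorter. *)
Lemma rdiff_le k G (s0 B : R) : 1 < s0 ->
  (forall j (s : R), (j < k)%N -> 1 < s -> is_derive s 1 (G j) (G j.+1 s)) ->
  (forall s, s0 <= s -> `|G k s| <= B) ->
  forall s, s0 <= s -> `|iter k rdiff (G 0%N) s| <= B.
Proof.
move=> s01; elim: k G => [|k ih] G dG GB s s0s; first exact: GB.
rewrite iterSr; apply: (ih (fun j => rdiff (G j))) => // {s s0s}.
  move=> j s jk s1.
  have d1 := dG j s (ltnW jk) s1.
  have d2 : is_derive (s + 1) 1 (G j) (G j.+1 (s + 1)).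
    by apply: dG; [exact: ltnW|lra].
  have d3 : is_derive s 1 (fun t => G j (t + 1)) (G j.+1 (s + 1)).
    have := @is_derive1_comp R (G j) (fun t => t + 1) s _ _ d2.
    move=> /(_ 1) H; rewrite -[X in is_derive _ _ _ X]mulr1; apply: H.
    by rewrite -[X in is_derive _ _ _ X]addr0; apply: is_deriveD.
  exact: is_deriveB.
move=> s s0s; have s1 : 1 < s by exact: lt_le_trans s0s.
have der (x : R) : s <= x -> is_derive x 1 (G k) (G k.+1 x).
  by move=> sx; apply: dG => //; exact: lt_le_trans sx.
have [|||c] := @MVT R (G k) (G k.+1) s (s + 1); rewrite ?ltrDl//.
- by move=> x; rewrite in_itv/= => /andP[/ltW + _]; exact: der.
- apply: derivable_within_continuous => x; rewrite in_itv/= => /andP[sx _].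
  by have [] := der _ sx.
- rewrite in_itv/= /rdiff => /andP[sc _] ->.
  rewrite addrAC subrr add0r mulr1 GB// (le_trans s0s)// ltW//.
Qed.

Lemma iter_fdiff_bound (a : nat -> R) j m (B : R) n :
  (forall i, (n <= i)%N -> `|iter j fdiff a i| <= B) ->
  forall i, (n <= i)%N -> `|iter (m + j) fdiff a i| <= 2 ^+ m * B.
Proof.
move=> aB; elim: m => [|m ih] i ni; first by rewrite expr0 mul1r aB.
rewrite addSn /= /fdiff (le_trans (ler_normB _ _))//.
by rewrite exprS -mulrA mulr2n mulrDl !mul1r lerD// ih// leqW.
Qed.

(** At [j = k] the bound of the class reads M s^(-delta). The integer [k] varies with [p]; the
    missing [m - k] differences at most double the bound each, and the factor [2 ^+ m] serves every
    [k]. *)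
Lemma class_L_fdiff_le (delta M : R) m p : 0 < delta -> 0 < M -> class_L delta M m p ->
  fdiff_le m (fun n => 2 ^+ m * M * n%:R `^ (- delta)) (fun n => p n%:R).
Proof.
move=> delta0 M0 [_ [k [km pder pB]]] n n1.
have M'0 : 0 <= M * n%:R `^ (- delta) by rewrite mulr_ge0 ?powR_ge0// ltW.
apply: (@le_trans _ _ (2 ^+ (m - k) * (M * n%:R `^ (- delta)))); last first.
  by rewrite -mulrA ler_wpM2r// ler_weXn2l ?ler1n ?leq_subr.
rewrite -{1}(subnK km); apply: (@iter_fdiff_bound _ _ _ _ n) => // i ni.
have n1' : 1 < n%:R :> R by rewrite ltr1n.
rewrite iter_fdiff_nat.
apply: (@rdiff_le k (fun j => ray_deriven j p) n%:R) => //; last by rewrite ler_nat.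
  move=> j s jk s1; apply: ray_is_derive => //.
  by apply: pder => //; exact: ltW.
move=> s ns; apply: (le_trans (pB _ _ (leqnn _) _)).
  by rewrite (le_trans _ ns)// ltW.
rewrite ler_wpM2l ?(ltW M0)// addrAC subrr add0r. rewrite !powRN lef_pV2 ?posrE ?powR_gt0//.
- by apply: ge0_ler_powR; rewrite ?nnegrE ?(ltW delta0)// (le_trans _ ns).
- by rewrite (lt_le_trans _ ns)// (lt_trans _ n1').
- by rewrite (lt_trans _ n1').
Qed.

Lemma cvg_fdiff_bound (delta M : R) m : 0 < delta ->
  (fun n => 2 ^+ m * M * n%:R `^ (- delta)) @ \oo --> (0 : R).
Proof.
move=> delta0.
have H : (fun n : nat => n%:R `^ (- delta)) @ \oo --> (0 : R).
  apply/cvgrPdist_le => eps eps0; near=> n.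
  rewrite sub0r normrN ger0_norm ?powR_ge0// powRN.
  have n0 : 0 < n%:R :> R by rewrite ltr0n; near: n; exact: nbhs_infty_gt.
  rewrite invf_ple ?posrE ?powR_gt0//.
  have -> : eps^-1 = (eps^-1 `^ delta^-1) `^ delta.
    by rewrite -powRrM mulVf ?gt_eqF// powRr1// invr_ge0 ltW.
  apply: ge0_ler_powR; rewrite ?nnegrE ?powR_ge0//; first exact: ltW.
  by near: n; exact: nbhs_infty_ger.
have := cvgMl_tmp (a := 2 ^+ m * M) H; rewrite mulr0 => H'; exact: (H' _).
Unshelve. all: by end_near. Qed.

End finite_differences.

(** * The maximal inequality and the ergodic theorem *)

Section birkhoff.
Context {R : realType} {d : measure_display} {X : measurableType d}.
Variables (mu : probability X R) (T : X -> X).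
Implicit Types (f g : X -> R) (x : X).

Definition birkhoff_sum g N x := \sum_(i < N) g (iter i T x).

Lemma birkhoff_sumS g N x : birkhoff_sum g N.+1 x = g x + birkhoff_sum g N (T x).
Proof.
rewrite /birkhoff_sum big_ord_recl/=; congr (_ + _).
by apply: eq_bigr => i _; rewrite -[in RHS]iterSr.
Qed.

Lemma measurable_iter n : measurable_fun [set: X] T -> measurable_fun [set: X] (iter n T).
Proof.
move=> mT; elim: n => [|n ih]; first exact: measurable_id.
exact: (measurableT_comp mT ih).
Qed.

Section preserving.
Hypothesis Tmu : measure_preserving mu T.
Let mT : measurable_fun [set: X] T := Tmu.1.

Lemma preserving_ge0_integral (f : X -> \bar R) : measurable_fun [set: X] f ->
  (forall x, 0 <= f x)%E -> (\int[mu]_x f (T x) = \int[mu]_x f x)%E.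
Proof.
move=> mf f0.
rewrite -[LHS](@ge0_integral_pushforward _ _ _ _ _ T mT mu [set: X] f)//=.
apply: eq_measure_integral => A mA _; exact: Tmu.2.
Qed.

Lemma preserving_integrable (f : X -> \bar R) :
  mu.-integrable [set: X] f -> mu.-integrable [set: X] (f \o T).
Proof.
move=> /integrableP[mf foo]; apply/integrableP; split; first exact: measurableT_comp mf mT.
rewrite (@preserving_ge0_integral (fun x => `|f x|%E))//.
exact: measurableT_comp.
Qed.

(* [birkhoff_max g n x] is the maximum of the first [n + 1] Birkhoff sums at [x]. *)
Fixpoint birkhoff_max g n x := if n is n'.+1 then
  Num.max 0 (g x + birkhoff_max g n' (T x)) else 0.

Lemma birkhoff_max_ge0 g n x : 0 <= birkhoff_max g n x.
Proof. by case: n => [//|n] /=; rewrite le_max lexx. Qed.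

Lemma birkhoff_maxS g n x : birkhoff_max g n x <= birkhoff_max g n.+1 x.
Proof.
elim: n x => [|n ih] x; first exact: birkhoff_max_ge0.
by rewrite /= le_max2// lerD2l ih.
Qed.

Lemma birkhoff_max_mono g m n x : (m <= n)%N -> birkhoff_max g m x <= birkhoff_max g n x.
Proof.
move=> /subnK <-; elim: (n - m)%N => [//|k ih]; rewrite addSn.
exact/(le_trans ih)/birkhoff_maxS.
Qed.

Lemma birkhoff_sum_le_max g n x : birkhoff_sum g n x <= birkhoff_max g n x.
Proof.
elim: n x => [|n ih] x; first by rewrite /birkhoff_sum big_ord0.
by rewrite birkhoff_sumS /= le_max lerD2l ih orbT.
Qed.

Lemma measurable_birkhoff_max g n : measurable_fun [set: X] g ->
  measurable_fun [set: X] (birkhoff_max g n).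
Proof.
move=> mg; elim: n => [|n ih]; first exact: measurable_cst.
apply: measurable_maxr; first exact: measurable_cst.
by apply: measurable_funD => //; exact: measurableT_comp.
Qed.

Lemma integrable_birkhoff_max g n : mu.-integrable [set: X] (EFin \o g) ->
  mu.-integrable [set: X] (EFin \o birkhoff_max g n).
Proof.
move=> ig; have mg : measurable_fun [set: X] g.
  by apply/measurable_EFinP; exact: measurable_int ig.
elim: n => [|n ih]; first exact: finite_measure_integrable_cst.
have i2 := integrableD measurableT ig (preserving_integrable ih).
apply: le_integrable i2 => //.
  by apply/measurable_EFinP; exact: measurable_birkhoff_max.
move=> x _ /=; rewrite lee_fin [leLHS]ger0_norm ?le_max ?lexx//.
by rewrite ge_max normr_ge0 ler_norm.
Qed.

(** Garsia's argument: where [M] is positive it equals [g] plus an earlier maximum at [T x], hence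
    is at most [g + M \o T]; elsewhere it vanishes. After integration the two integrals of [M]
    cancel by invariance. *)
Lemma maximal_ergodic g n : mu.-integrable [set: X] (EFin \o g) ->
  (0 <= \int[mu]_x (g x * (0 < birkhoff_max g n.+1 x)%R%:R)%:E)%E.
Proof.
move=> ig; have mg : measurable_fun [set: X] g.
  by apply/measurable_EFinP; exact: measurable_int ig.
set M := birkhoff_max g n.+1.
have mM : measurable_fun [set: X] M by exact: measurable_birkhoff_max.
have iM := integrable_birkhoff_max n.+1 ig; rewrite -/M in iM.
set h := fun x => _.
have ih : mu.-integrable [set: X] h.
  apply: le_integrable ig => //.
    apply/measurable_EFinP; apply: measurable_funM => //.
    apply: (@measurable_comp _ _ _ _ _ _ setT (fun b : bool => b%:R : R)) => //.
    exact: measurable_fun_ltr.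
  by move=> x _; rewrite lee_fin normrM; case: ltP; rewrite (normr0, normr1) (mulr0, mulr1).
have H : (\int[mu]_x (EFin \o M) x <= \int[mu]_x (h x + (EFin \o M \o T) x))%E.
  apply: le_integral => //.
    by apply: integrableD => //; exact: preserving_integrable.
  move=> x _; rewrite /h /= -EFinD lee_fin.
  case: ltP => M0; last by rewrite mulr0 add0r (le_trans M0)// birkhoff_max_ge0.
  rewrite mulr1.
  have -> : M x = g x + birkhoff_max g n (T x).
    by move: M0; rewrite /M /=; case: (leP 0); rewrite ?ltxx.
  by rewrite lerD2l birkhoff_maxS.
rewrite integralD// in H; last exact: preserving_integrable.
rewrite (@preserving_ge0_integral (EFin \o M)) in H; first last.
- by move=> x; rewrite lee_fin birkhoff_max_ge0.
- exact/measurable_EFinP.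
rewrite -[leLHS]add0e leeD2rE// in H.
exact: integrable_fin_num.
Qed.

(** The sets where [birkhoff_max] is positive increase to a set of full measure, and [g] dominates
    in the passage to the limit. *)
Lemma maximal_ergodic_ae g : mu.-integrable [set: X] (EFin \o g) ->
  {ae mu, forall x, exists n, 0 < birkhoff_sum g n x} ->
  (0 <= \int[mu]_x (g x)%:E)%E.
Proof.
move=> ig gpos; have mg : measurable_fun [set: X] g.
  by apply/measurable_EFinP; exact: measurable_int ig.
pose h n x := (g x * (0 < birkhoff_max g n.+1 x)%R%:R)%:E.
have [|||||_ _ H] := @dominated_convergence _ _ _ mu setT measurableT h (EFin \o g)
  (abse \o EFin \o g).
- move=> n; apply/measurable_EFinP; apply: measurable_funM => //.
  apply: (@measurable_comp _ _ _ _ _ _ setT (fun b : bool => b%:R : R)) => //.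
  by apply: measurable_fun_ltr => //; exact: measurable_birkhoff_max.
- exact/measurable_EFinP.
- apply: filterS gpos => x [n xn] _.
  apply: cvg_near_cst; exists n => // m /= nm.
  rewrite /h (lt_le_trans xn) ?mulr1//.
  rewrite (le_trans (birkhoff_sum_le_max _ _ _))// birkhoff_max_mono// leqW//.
- exact: integrable_abse.
- apply: nearW => x n _; rewrite lee_fin normrM.
  by case: ltP; rewrite (normr0, normr1) (mulr0, mulr1).
apply: (cvge_ge _ H).
by apply: nearW => n; exact: maximal_ergodic.
Qed.

End preserving.

(* The margin [j.+1%:R^-1] makes the set of the points whose Birkhoff sums satisfy
   this condition strictly invariant, even for unbounded functions. *)
Definition birkhoff_exceed (c : R) (u : nat -> R) :=
  exists j : nat, forall N0 : nat, exists2 N : nat, (N0 <= N)%N &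
    (c + j.+1%:R^-1) * N%:R < u N.

(** For large [N], half the margin absorbs both the constant [D] and the shift of the index. The
    witness [(2 * j.+1)%N.-1] is the index whose margin is half that of [j]. *)
Lemma birkhoff_exceed_shift (c D : R) (u v : nat -> R) :
  (forall N, u N.+1 = v N + D) -> birkhoff_exceed c u <-> birkhoff_exceed c v.
Proof.
move=> uv.
have half j : (2 * j.+1)%N.-1.+1 = (2 * j.+1)%N by [].
have inv j : (2 * j.+1)%N%:R^-1 = j.+1%:R^-1 / 2 :> R by rewrite natrM invfM mulrC.
have j0 j : 0 < j.+1%:R^-1 :> R by rewrite invr_gt0.
split=> -[j uj]; exists (2 * j.+1)%N.-1 => N0; rewrite half inv.
  set N1 := Num.bound (`|(D - c - j.+1%:R^-1) / (j.+1%:R^-1 / 2)|).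
  have [[//|N]] := uj (N0 + N1).+1.
  rewrite ltnS => NN; rewrite uv => cN; exists N; first exact: leq_trans (leq_addr _ _) NN.
  have : `|(D - c - j.+1%:R^-1) / (j.+1%:R^-1 / 2)| < N%:R.
    by rewrite (lt_le_trans (archi_boundP _))// ler_nat (leq_trans _ NN)// leq_addl.
  move=> /ltr_normlW; rewrite ltr_pdivrMr ?divr_gt0//.
  move: cN; rewrite -natr1; move: (j0 j); set t := j.+1%:R^-1 => t0; nra.
set N1 := Num.bound (`|(c + j.+1%:R^-1 / 2 - D) / (j.+1%:R^-1 / 2)|).
have [N] := uj (N0 + N1)%N.
move=> NN cN; exists N.+1; first exact: leqW (leq_trans (leq_addr _ _) NN).
have : `|(c + j.+1%:R^-1 / 2 - D) / (j.+1%:R^-1 / 2)| < N%:R.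
  by rewrite (lt_le_trans (archi_boundP _))// ler_nat (leq_trans _ NN)// leq_addl.
move=> /ltr_normlW; rewrite ltr_pdivrMr ?divr_gt0// uv.
move: cN; rewrite -natr1; move: (j0 j); set t := j.+1%:R^-1 => t0; nra.
Qed.

Lemma measurable_birkhoff_exceed (c : R) (u : nat -> X -> R) :
  (forall N, measurable_fun [set: X] (u N)) ->
  measurable [set x | birkhoff_exceed c (u ^~ x)].
Proof.
move=> mu_.
have -> : [set x | birkhoff_exceed c (u ^~ x)] =
  \bigcup_j \bigcap_N0 \bigcup_(N in [set N | (N0 <= N)%N])
    (u N @^-1` `](c + j.+1%:R^-1) * N%:R, +oo[%classic).
  apply/seteqP; split=> x.
    move=> [j ju]; exists j => // N0 _; have [N N0N uN] := ju N0; exists N => //=.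
    by rewrite in_itv/= uN.
  move=> [j _ ju]; exists j => N0; have [N N0N uN] := ju N0 I; exists N => //.
  by move: uN; rewrite /= in_itv/= andbT.
apply: bigcup_measurable => j _; apply: bigcap_measurable => // N0 _.
apply: bigcup_measurable => N _.
by rewrite -[X in measurable X]setTI; exact: mu_.
Qed.

(** The points that exceed the intermediate level [c'] form an invariant set. If it is null, the
    sums eventually stay below level [c]; if it has full measure, the maximal inequality for
    [g - c'] contradicts the choice of [c'] above the integral. *)
Theorem birkhoff_upper g (c : R) : ergodic mu T -> mu.-integrable [set: X] (EFin \o g) ->
  \int[mu]_x g x < c ->
  {ae mu, forall x, \forall N \near \oo,
     \sum_(1 <= n < N.+1) g (iter n T x) <= c * N%:R}.
Proof.
move=> [Tmu erg] ig gc; have mg : measurable_fun [set: X] g.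
  by apply/measurable_EFinP; exact: measurable_int ig.
pose c' := (\int[mu]_x g x + c) / 2.
have gc' : \int[mu]_x g x < c' by rewrite /c'; lra.
have c'c : c' < c by rewrite /c'; lra.
pose u N x := \sum_(1 <= n < N.+1) g (iter n T x).
have uE N x : u N x = birkhoff_sum g N.+1 x - g x.
  by rewrite /u /birkhoff_sum big_add1 big_mkord big_ord_recl addrAC subrr add0r.
have mu_ N : measurable_fun [set: X] (u N).
  apply: measurable_sum => i.
  exact: (measurableT_comp mg (measurable_iter i Tmu.1)).
pose B := [set x | birkhoff_exceed c' (u ^~ x)].
have mB : measurable B by exact: measurable_birkhoff_exceed.
have uT N x : u N.+1 x = u N (T x) + g (T x).
  by rewrite !uE (birkhoff_sumS _ N.+1 x); ring.
have TB : T @^-1` B = B.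
  apply/seteqP; split => x /=; rewrite /B/=;
    by have [] := @birkhoff_exceed_shift c' (g (T x)) (u ^~ x) (u ^~ (T x)) (uT ^~ x).
have [B0|B1] := erg B mB TB.
  exists B; split => // x /=; apply: contra_notP => /= Bx.
  have cc' : 0 < c - c' by rewrite subr_gt0.
  (* The margin of this [j] fits between [c'] and [c]. *)
  set j := Num.bound (c - c')^-1.
  have jc : j.+1%:R^-1 <= c - c'.
    rewrite invf_ple ?posrE// (@le_trans _ _ j%:R) ?ler_nat//.
    by rewrite ltW// archi_boundP// invr_ge0 ltW.
  have /existsNP[N0 N0x] : ~ forall N0, exists2 N, (N0 <= N)%N &
    (c' + j.+1%:R^-1) * N%:R < u N x by move=> H; apply: Bx; exists j.
  exists N0 => // N /= N0N; rewrite leNgt; apply/negP => cu.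
  apply: N0x; exists N => //; apply: le_lt_trans cu.
  by rewrite ler_wpM2r// addrC -lerBrDr.
have ic : mu.-integrable [set: X] (EFin \o cst c') by exact: finite_measure_integrable_cst.
have igc : mu.-integrable [set: X] (EFin \o (fun x => g x - c')).
  by have := integrableB measurableT ig ic; apply: eq_integrable => // x _.
have : (0 <= \int[mu]_x (g x - c')%:E)%E.
  apply: (maximal_ergodic_ae Tmu igc).
  exists (~` B); split; first exact: measurableC.
    by rewrite probability_setC// B1 subee.
  move=> x; apply: contra_not => Bx.
  (* [u] starts at time [1] and [birkhoff_sum] at time [0]; the shift lemma carries the excess over,
     and it makes some Birkhoff sum of [g - c'] positive. *)
  have vu N : birkhoff_sum g N.+1 x = u N x + g x by rewrite uE subrK.
  have [_ /(_ Bx)] := @birkhoff_exceed_shift c' (g x) (birkhoff_sum g ^~ x) (u ^~ x) vu.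
  move=> [j /(_ 0%N)[N _ jN]]; exists N.
  rewrite /birkhoff_sum sumrB sumr_const card_ord -mulr_natr subr_gt0.
  apply: le_lt_trans jN; rewrite ler_wpM2r// lerDl invr_ge0//.
rewrite (_ : (fun x => (g x - c')%:E) = (fun x => (g x)%:E - (cst c' x)%:E)%E)//.
rewrite integralB_EFin//= integral_cst//.
have -> : (c'%:E * (mu : {measure set X -> \bar R}) [set: X] = c'%:E)%E.
  by rewrite -[RHS]mule1; congr (_ * _)%E; exact: probability_setT.
rewrite -[X in (X - _)%E]fineK ?integrable_fin_num//.
by rewrite -EFinB lee_fin subr_ge0 leNgt gc'.
Qed.

End birkhoff.

(** * Invariant measures from invariant contents *)

Section krylov_bogoliubov.
Context {R : realType} {X : pmetricType R}.
Local Notation borel := (g_sigma_algebraType (@open X)).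
Hypothesis cptX : compact [set: X].

Section content.
Variable lambda : set X -> R.
Hypothesis lambda_ge0 : forall A, 0 <= lambda A.
Hypothesis lambdaT : lambda setT = 1.
Hypothesis lambdaU : forall A B, A `&` B = set0 -> lambda (A `|` B) = lambda A + lambda B.

Lemma content_set0 : lambda set0 = 0.
Proof.
by have := lambdaU (setI0 set0); rewrite setU0; lra.
Qed.

Lemma content_mono A B : A `<=` B -> lambda A <= lambda B.
Proof.
by move=> AB; rewrite -(setDUK AB) lambdaU ?lerDl// setDE setICA setICr setI0.
Qed.


Local Open Scope ereal_scope.

(** Regularization from inside by closed sets: on open sets it is countably subadditive, while
    [lambda] is only finitely additive. *)
Definition inner_content (U : set X) : \bar R :=
  ereal_sup [set (lambda K)%:E | K in [set K | closed K /\ K `<=` U]].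

Lemma le_inner_content K U : closed K -> K `<=` U -> (lambda K)%:E <= inner_content U.
Proof. by move=> cK KU; apply: ereal_sup_ubound; exists K. Qed.

Lemma inner_content_le U a : (forall K, closed K -> K `<=` U -> (lambda K)%:E <= a) ->
  inner_content U <= a.
Proof. by move=> Ka; apply: ge_ereal_sup => _ [K [cK KU] <-]; exact: Ka. Qed.

Lemma inner_content_ge0 U : 0 <= inner_content U.
Proof.
rewrite (le_trans _ (@le_inner_content set0 U closed0 (@sub0set _ _)))//.
by rewrite lee_fin.
Qed.

Lemma inner_content_le1 U : inner_content U <= 1.
Proof.
by apply: inner_content_le => K _ _; rewrite lee_fin -lambdaT content_mono.
Qed.

Lemma inner_content_fin U : inner_content U \is a fin_num.
Proof.
by rewrite ge0_fin_numE ?inner_content_ge0// (le_lt_trans (inner_content_le1 U))// ltry.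
Qed.

Lemma inner_content0 : inner_content set0 = 0.
Proof.
apply/eqP; rewrite eq_le inner_content_ge0 andbT.
by apply: inner_content_le => K _; rewrite subset0 => ->; rewrite content_set0.
Qed.

Lemma inner_content_mono U V : U `<=` V -> inner_content U <= inner_content V.
Proof.
move=> UV; apply: inner_content_le => K cK KU.
exact: le_inner_content (subset_trans KU UV).
Qed.

(** By normality, the part of [K] outside [U] has a neighbourhood with closure in [V]; this covers
    [K] by a closed piece inside [U] and another inside [V]. *)
Lemma inner_content_setU U V : open U -> open V ->
  inner_content (U `|` V) <= inner_content U + inner_content V.
Proof.
move=> oU oV; apply: inner_content_le => K cK KUV.
have cKU : closed (K `\` U) by rewrite setDE; apply: closedI => //; exact: open_closedC.
have KUV' : K `\` U `<=` V by move=> x [Kx nUx]; case: (KUV _ Kx).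
have VnK : set_nbhs (K `\` U) V by move=> x /KUV' Vx; exact: open_nbhs_nbhs.
have [W WnK WV] := compact_normal (@metric_hausdorff _ X) cptX cKU VnK.
have /set_nbhsP[W' [oW' KW' W'W]] := WnK.
rewrite (@le_trans _ _ (lambda (K `\` W') + lambda (K `&` closure W))%:E)//.
  rewrite lee_fin.
  have -> : lambda K = lambda ((K `\` W') `|` (K `&` W'))%R by rewrite setUC setUIDK.
  rewrite lambdaU; last by rewrite setDE setIACA [~` _ `&` _]setIC setICr setI0.
  rewrite lerD2l content_mono//; apply: setIS.
  exact: subset_trans W'W (@subset_closure _ _).
rewrite EFinD leeD// le_inner_content//.
- by rewrite setDE; apply: closedI => //; exact: open_closedC.
- move=> x [Kx nW'x]; apply: contrapT => nUx; apply: nW'x.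
  exact: KW'.
- by apply: closedI => //; exact: closed_closure.
- by move=> x [_ /WV].
Qed.

(** A closed [K] inside the union is compact, hence lies in a finite subunion. *)
Lemma inner_content_bigcup (U : (set X)^nat) : (forall i, open (U i)) ->
  inner_content (\bigcup_i U i) <= \sum_(i <oo) inner_content (U i).
Proof.
move=> oU; apply: inner_content_le => K cK KU.
have fin n : inner_content (\big[setU/set0]_(i < n) U i) <= \sum_(i < n) inner_content (U i).
  elim: n => [|n ih]; first by rewrite !big_ord0 inner_content0.
  rewrite !big_ord_recr/= (le_trans (inner_content_setU _ _))//; last exact: leeD2r.
  by rewrite -bigcup_mkord; apply: bigcup_open => i _.
have cptK : compact K by apply: subclosed_compact cptX _.
have : \forall n \near \oo, K `<=` \big[setU/set0]_(i < n) U i.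
  move/compact_near_coveringP : cptK; apply => x /KU [i _ Uix].
  exists (U i, [set n | (i < n)%N]) => /=.
    by split; [exact: open_nbhs_nbhs|exists i.+1].
  move=> [y n] /= [Uiy iN]; rewrite -bigcup_mkord.
  by exists i.
move=> [n _ /(_ n (leqnn _)) Kn].
rewrite (le_trans (le_inner_content cK Kn))// (le_trans (fin n))//.
rewrite -(big_mkord xpredT (fun i => inner_content (U i))).
by apply: nneseries_lim_ge => i _ _; exact: inner_content_ge0.
Qed.

Definition open_content (A : set X) : \bar R :=
  if `[< open A >] then inner_content A else +oo.

Lemma open_content_open U : open U -> open_content U = inner_content U.
Proof. by move=> oU; rewrite /open_content asboolT. Qed.

Lemma open_content0 : open_content set0 = 0.
Proof. by rewrite open_content_open ?inner_content0//; exact: open0. Qed.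

Lemma open_content_ge0 A : 0 <= open_content A.
Proof. by rewrite /open_content; case: ifP => // _; exact: inner_content_ge0. Qed.

(* All subsets are measurable in the auxiliary space over which the covers of
   [mu_ext] range; the infinite value of [open_content] leaves only the open covers. *)
Definition content_ext : set X -> \bar R :=
  @mu_ext _ (g_sigma_algebraType [set: set X]) R open_content.

HB.instance Definition _ := isOuterMeasure.Build R X content_ext
  (@mu_ext0 _ (g_sigma_algebraType [set: set X]) _ _ open_content0 open_content_ge0)
  (@mu_ext_ge0 _ (g_sigma_algebraType [set: set X]) _ _ open_content_ge0)
  (@le_mu_ext _ (g_sigma_algebraType [set: set X]) _ open_content)
  (@mu_ext_sigma_subadditive _ (g_sigma_algebraType [set: set X]) _ _ open_content_ge0).

(** The union of an open cover is itself an open superset, and a cover with a member that is not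
    open has infinite total. *)
Lemma content_ext_ge (A : set X) a :
  (forall U, open U -> A `<=` U -> a <= inner_content U) -> a <= content_ext A.
Proof.
move=> aU; apply: le_ereal_inf_tmp => _ [F [_ AF] <-].
have [oF|] := pselect (forall i, open (F i)).
  apply: (le_trans (aU _ (bigcup_open (fun i _ => oF i)) AF)).
  rewrite (le_trans (inner_content_bigcup oF))//.
  by rewrite (eq_eseriesr (fun i _ => open_content_open (oF i))).
move=> /existsNP[i nF]; rewrite (@eseries_pinfty _ _ xpredT i) ?leey//.
  by move=> n _; rewrite gt_eqF// (lt_le_trans ltNy0)// open_content_ge0.
by rewrite /open_content asboolF.
Qed.

Lemma content_ext_open (U : set X) : open U -> content_ext U = inner_content U.
Proof.
move=> oU; apply/eqP; rewrite eq_le; apply/andP; split; last first.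
  by apply: content_ext_ge => V _; exact: inner_content_mono.
have : content_ext U <= content_ext U by [].
move=> /le_trans; apply.
apply: ereal_inf_lbound; exists (fun i => if i is 0%N then U else set0).
  split; last by move=> x Ux; exists 0%N.
  by move=> i; exact: sub_sigma_algebra.
rewrite nneseries_recl//; last by move=> i _; exact: open_content_ge0.
rewrite open_content_open//.
by rewrite eseries0 ?adde0// => -[//|i] _ _; exact: open_content0.
Qed.

Lemma content_ext_mono (A B : set X) : A `<=` B -> content_ext A <= content_ext B.
Proof. exact: le_outer_measure. Qed.

Lemma content_ext_fin (A : set X) : content_ext A \is a fin_num.
Proof.
rewrite ge0_fin_numE; last exact: outer_measure_ge0.
rewrite (le_lt_trans (content_ext_mono (@subsetT _ A)))//.
by rewrite content_ext_open ?(le_lt_trans (inner_content_le1 _)) ?ltry//; exact: openT.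
Qed.

(** Let [V] be an open superset of [A]. A closed [K] in the intersection of [V] and [U] and a closed
    [L] in [V] minus [K] are disjoint, so [lambda K + lambda L] is at most the content of [V];
    suprema over [L] and [K] give the splitting inequality. *)
Lemma open_caratheodory (U : set X) : open U -> content_ext.-caratheodory U.
Proof.
move=> oU; apply: le_caratheodory_measurable => A.
apply: content_ext_ge => V oV AV.
have fin := content_ext_fin.
rewrite -leeBrDr//; apply: (@le_trans _ _ (inner_content (V `&` U))).
  rewrite -content_ext_open; last exact: openI.
  by apply: content_ext_mono; exact: setSI.
apply: inner_content_le => K cK KVU.
have oVK : open (V `\` K) by rewrite setDE; apply: openI => //; exact: closed_openC.
have VKfin := inner_content_fin (V `\` K).
rewrite leeBrDr//.
apply: (@le_trans _ _ ((lambda K)%:E + inner_content (V `\` K))).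
  rewrite leeD2l// -content_ext_open//; apply: content_ext_mono => x [Ax nUx].
  by split; [exact: AV|move=> /KVU[]].
rewrite addeC -leeBrDr//; apply: inner_content_le => L cL LVK.
rewrite leeBrDr// -EFinD -lambdaU; last first.
  by rewrite -subset0 => x [/LVK[_ nKx] Kx].
apply: le_inner_content; first exact: closedU.
by move=> x [/LVK[]//|/KVU[]].
Qed.

Lemma borel_caratheodory (A : set borel) : measurable A -> content_ext.-caratheodory A.
Proof.
move=> mA; apply: (mA (content_ext.-caratheodory)); split; last exact: open_caratheodory.
split.
- exact: caratheodory_measurable_set0.
- by move=> B mB; rewrite setTD; exact: caratheodory_measurable_setC.
- exact: caratheodory_measurable_bigcup.
Qed.

Definition borel_ext : set borel -> \bar R := content_ext.

Lemma borel_ext_sigma_additive : semi_sigma_additive borel_ext.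
Proof.
move=> F mF tF mUF.
have := @caratheodory_measure_sigma_additive R X content_ext F.
apply => //; first by move=> i; exact: borel_caratheodory.
exact: borel_caratheodory.
Qed.

HB.instance Definition _ := isMeasure.Build _ borel R borel_ext
  (outer_measure0 content_ext) (outer_measure_ge0 content_ext) borel_ext_sigma_additive.

Lemma borel_extT : borel_ext setT = 1.
Proof.
rewrite /borel_ext content_ext_open; last exact: openT.
apply/eqP; rewrite eq_le inner_content_le1 -lambdaT /=.
by apply: le_inner_content => //; exact: closedT.
Qed.

HB.instance Definition _ := Measure_isProbability.Build _ borel R borel_ext borel_extT.

Variable T : X -> X.
Hypothesis T_continuous : continuous T.
Hypothesis lambda_invariant : forall A, lambda (T @^-1` A) = lambda A.

(** Open sets form a generating pi-system. On them the two inequalities come from the images of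
    closed sets, closed by compactness, and from their preimages, closed by continuity. *)
Lemma borel_ext_preserving : measure_preserving (borel_ext : probability borel R) T.
Proof.
have mT : measurable_fun [set: borel] (T : borel -> borel).
  apply: (@measurability _ _ borel borel setT T (@open X)) => // _ [U oU <-].
  rewrite setTI; apply: sub_sigma_algebra.
  by move/continuousP : T_continuous; exact.
split => // A mA.
pose nu : measure borel R := @pushforward _ _ borel borel R borel_ext T.
rewrite -[LHS]/(nu mT A).
apply: (@measure_unique _ R borel (@open X) (fun=> setT)) => //.
- by move=> U V; exact: openI.
- by move=> _; exact: openT.
- by rewrite bigcup_const//; exists 0%N.
- move=> U oU.
  have oTU : open (T @^-1` U) by move/continuousP : T_continuous; exact.
  rewrite /= /pushforward /borel_ext !content_ext_open//.
  apply/eqP; rewrite eq_le; apply/andP; split; apply: inner_content_le => K cK KU.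
    have cTK : closed (T @` K).
      apply: compact_closed; first exact: metric_hausdorff.
      apply: continuous_compact; first exact: continuous_subspaceT.
      exact: subclosed_compact cptX _.
    rewrite (@le_trans _ _ (lambda (T @` K))%:E)//.
      by rewrite lee_fin -(lambda_invariant (T @` K)) content_mono//; exact: preimage_image.
    by apply: le_inner_content => // _ [x /KU Ux <-].
  rewrite -lambda_invariant; apply: le_inner_content; last by move=> x /KU.
  by move/continuous_closedP : T_continuous; exact.
- by move=> _; rewrite /= /pushforward borel_extT ltry.
Qed.

(** Every open superset of [F] has inner content at least [lambda F], so the outer measure of [F] is
    at least that; uniqueness identifies it with [mu F]. *)
Lemma invariant_content_closed (mu : probability borel R) (F : set X) :
  unique_invariant_probability mu T -> closed F -> (lambda F)%:E <= mu F.
Proof.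
move=> [_ uniq] cF.
rewrite -(uniq (borel_ext : probability borel R) borel_ext_preserving); last first.
  rewrite -[F]setCK; apply: measurableC; apply: sub_sigma_algebra.
  exact: closed_openC.
by apply: content_ext_ge => U _; exact: le_inner_content.
Qed.

End content.
End krylov_bogoliubov.

(** * Uniform averages in uniquely ergodic systems *)

(** Compactness gives a cluster point, and an ultrafilter converges to its cluster points: it
    contains each preimage of a neighbourhood or its complement, and clustering excludes the
    complement. *)
Lemma ultra_segment_cvg {R : realType} (U : set_system nat) (a b : R) (v : nat -> R) :
  UltraFilter U -> (forall k, a <= v k <= b) -> cvg (v @ U).
Proof.
move=> UU vab; have PU : ProperFilter U by exact: ultra_proper.
have : (v @ U) `[a, b]%classic by apply: nearW => k; rewrite /= in_itv/=; exact: vab.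
move=> /(@segment_compact R a b _ (fmap_proper_filter v PU))[p [_ clp]].
apply/cvg_ex; exists p => B Bp.
have [//|UB] := in_ultra_setVsetC (v @^-1` B) UU.
have [x [+ Bx]] := clp (~` B) B UB Bp.
by case.
Qed.

Section uniform_averages.
Context {R : realType} {X : pmetricType R}.
Local Notation borel := (g_sigma_algebraType (@open X)).
Hypothesis cptX : compact [set: X].
Variables (mu : probability borel R) (T : X -> X).
Hypothesis T_continuous : continuous T.
Hypothesis mu_unique : unique_invariant_probability mu T.

Lemma closed_measurable (F : set X) : closed F -> measurable (F : set borel).
Proof.
move=> cF; rewrite -[F]setCK; apply: measurableC.
by apply: sub_sigma_algebra; exact: closed_openC.
Qed.

Lemma continuous_borel_measurable (g : X -> R) : continuous g ->
  measurable_fun [set: borel] (g : borel -> R).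
Proof.
move=> /continuousP cg; apply: (measurability _ (RGenOpens.measurableE R)).
move=> _ [_ [a [b ->] <-]]; rewrite setTI.
by apply: sub_sigma_algebra; exact: cg (interval_open _ _).
Qed.

Lemma continuous_bounded (g : X -> R) : continuous g ->
  exists2 C : R, 0 < C & forall x, `|g x| <= C.
Proof.
move=> cg; have cgw : {within [set: X], continuous g} by exact: continuous_subspaceT.
have [C [_ HC]] := compact_bounded (continuous_compact cgw cptX).
exists (Num.max 0 C + 1); first by rewrite ltr_wpDl// le_max lexx.
move=> x; apply: HC; last by exists x.
by rewrite (@le_lt_trans _ _ (Num.max 0 C)) ?ltrDl// le_max lexx orbT.
Qed.

Lemma continuous_integrable (g : X -> R) : continuous g ->
  mu.-integrable [set: borel] (EFin \o g).
Proof.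
move=> cg; have [C _ gC] := continuous_bounded cg.
apply: measurable_bounded_integrable => //.
- by rewrite (le_lt_trans (probability_le1 _ _)) ?ltry.
- exact: continuous_borel_measurable.
- exists C; split; first exact: num_real.
  by move=> M /ltW CM x _ /=; rewrite (le_trans (gC x)).
Qed.

Definition visits (A : set X) (N : nat) (x : X) : R :=
  \sum_(1 <= n < N.+1) \1_A (iter n T x).

Lemma closed_average (F : set X) (b : R) : closed F -> (mu F < b%:E)%E ->
  \forall N \near \oo, forall x, visits F N x <= b * N%:R.
Proof.
move=> cF Fb; apply: contrapT => bad.
have /choice[f fP] : forall k, exists Nx : nat * X,
    (k <= Nx.1)%N /\ b * Nx.1%:R < visits F Nx.1 Nx.2.
  move=> k; apply: contrapT => kb; apply: bad; exists k => // N /= kN x.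
  by rewrite leNgt; apply/negP => bN; apply: kb; exists (N, x).
pose v A k := (f k).1%:R^-1 * visits A (f k).1 (f k).2.
have b_gt0 : 0 < b.
  by rewrite -lte_fin (le_lt_trans _ Fb).
(* At time zero both sides of the violated bound vanish, so the strict violation forces a positive
   time. *)
have f_gt0 k : 0 < (f k).1%:R :> R.
  rewrite ltr0n lt0n; apply/eqP => fk0; have [_] := fP k.
  by rewrite /visits fk0 big_geq// mulr0 ltxx.
have visits01 A N x : 0 <= visits A N x <= N%:R.
  rewrite sumr_ge0//=.
  rewrite (@le_trans _ _ (\sum_(1 <= n < N.+1) 1))//.
    by apply: ler_sum => n _; rewrite indicE lern1 leq_b1.
  by rewrite sumr_const_nat subn1.
have v01 A k : 0 <= v A k <= 1.
  have /andP[v0 v1] := visits01 A (f k).1 (f k).2.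
  by rewrite mulr_ge0 ?invr_ge0//= ler_pdivrMl// mulr1.
(* An ultrafilter finer than [\oo] makes the frequencies converge for all subsets at once. *)
have [U [UU ooU]] := ultraFilterLemma (eventually_filter : ProperFilter \oo).
have PU : ProperFilter U by exact: ultra_proper.
pose lambda A := lim (v A @ U).
have v_cvg A : v A @ U --> lambda A by exact: ultra_segment_cvg (v01 A).
have lambda_ge0 A : 0 <= lambda A.
  apply: limr_ge; first exact: ultra_segment_cvg (v01 A).
  by apply: nearW => k; have /andP[] := v01 A k.
have lambda_unique A (l : R) : v A @ U --> l -> lambda A = l.
  by move=> vl; exact: cvg_lim vl.
have lambdaT : lambda setT = 1.
  apply: lambda_unique; rewrite (_ : v setT = cst 1); first exact: cvg_cst.
  apply/funext => k; rewrite /v /visits.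
  under eq_bigr do rewrite indicT.
  by rewrite sumr_const_nat subn1 mulVf// gt_eqF.
have lambdaU A B : A `&` B = set0 -> lambda (A `|` B) = lambda A + lambda B.
  move=> AB; apply: lambda_unique.
  rewrite (_ : v (A `|` B) = v A \+ v B); first exact: cvgD.
  apply/funext => k; rewrite /v /visits /= -mulrDr -big_split/=; congr (_ * _).
  apply: eq_bigr => n _; rewrite !indicE in_setU.
  have [xA|] := boolP (_ \in A); have [xB|] := boolP (_ \in B); rewrite ?addr0 ?add0r//.
  have : (A `&` B) (iter n T (f k).2) by split; exact: set_mem.
  by rewrite AB.
have lambda_invariant A : lambda (T @^-1` A) = lambda A.
  apply: lambda_unique.
  (* The frequencies of [A] and of its preimage differ by a telescoping sum divided by the orbit
     length, which is at least [k]; the difference vanishes along [\oo], hence along [U]. *)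
  have -> : v (T @^-1` A) = v A \+ (v (T @^-1` A) \- v A).
    by apply/funext => k /=; rewrite addrC subrK.
  rewrite -[X in _ --> X]addr0; apply: cvgD => //.
  apply: (@cvg_trans _ ((v (T @^-1` A) \- v A) @ \oo)).
    by apply: cvg_app.
  apply/cvgrPdist_le => eps eps0; near=> k.
  rewrite sub0r normrN /= /v -mulrBr /visits -sumrB.
  rewrite (telescope_sumr_eq (fun n => \1_A (iter n T (f k).2)))//.
  rewrite normrM ger0_norm ?invr_ge0// ler_pdivrMl//.
  rewrite (@le_trans _ _ 1)//.
    rewrite !indicE; case: (_ \in A); case: (_ \in A);
      by rewrite ?subrr ?subr0 ?sub0r ?normrN ?normr0 ?normr1.
  rewrite mulrC -ler_pdivrMl// mulr1 (@le_trans _ _ k%:R)//.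
    by near: k; exact: nbhs_infty_ger.
  by rewrite ler_nat; have [] := fP k.
have := invariant_content_closed cptX lambda_ge0 lambdaT lambdaU T_continuous
  lambda_invariant mu_unique cF.
apply/negP; rewrite -ltNge (lt_le_trans Fb)// lee_fin.
apply: limr_ge; first exact: ultra_segment_cvg (v01 F).
apply: nearW => k; have [_ /ltW bk] := fP k.
by rewrite /v ler_pdivlMl// mulrC.
Unshelve. all: by end_near. Qed.

(** For [y] between [0] and [n] the sum is the integer part of [y]; together with [floor_sum_ge] it
    recovers [y] up to [1]. *)
Lemma floor_sum_le (y : R) n : 0 <= y -> \sum_(i < n) (i.+1%:R <= y)%R%:R <= y.
Proof.
move=> y0; elim: n => [|n ih]; first by rewrite big_ord0.
rewrite big_ord_recr/=; have [ny|ny] := leP n.+1%:R y; last by rewrite addr0.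
rewrite (le_trans _ ny)// -natr1 lerD//.
rewrite (@le_trans _ _ (\sum_(i < n) 1))//.
  by apply: ler_sum => i _; rewrite lern1 leq_b1.
by rewrite sumr_const card_ord.
Qed.

Lemma floor_sum_ge (y : R) n : y <= n%:R -> y - 1 <= \sum_(i < n) (i.+1%:R <= y)%R%:R.
Proof.
elim: n => [|n ih] yn; first by rewrite big_ord0; lra.
rewrite big_ord_recr/=; have [{}/ih ih|ny] := leP y n%:R.
  by rewrite (le_trans ih)// lerDl.
have -> : \sum_(i < n) (i.+1%:R <= y)%R%:R = n%:R :> R.
  rewrite -[RHS]mulr1 mulr_natl -[X in _ *+ X]card_ord -sumr_const.
  apply: eq_bigr => i _; rewrite (_ : _ <= _)//.
  by rewrite (le_trans _ (ltW ny))// ler_nat.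
apply: (@le_trans _ _ n%:R); last by rewrite lerDl.
by move: yn; rewrite -natr1; lra.
Qed.

(** Layer-cake approximation: [n%:R * h] is within [1] of the sum of the indicators of its closed
    superlevel sets [F i], and [closed_average] applies to each of them. *)
Lemma unit_average (h : X -> R) (b : R) : continuous h ->
  (forall x, 0 <= h x <= 1) -> \int[mu]_x h x < b ->
  \forall N \near \oo, forall x, \sum_(1 <= n < N.+1) h (iter n T x) <= b * N%:R.
Proof.
move=> ch h01 hb; have mh := continuous_borel_measurable ch.
have h0 x : 0 <= h x by have /andP[] := h01 x.
have ih := continuous_integrable ch.
set I := \int[mu]_x h x in hb.
have IE : (\int[mu]_x (h x)%:E = I%:E)%E.
  by rewrite /I /Rintegral fineK// integrable_fin_num.
(* One third of the gap goes to the visits of the sets [F i], one to the rounding error [n%:R^-1],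
   and one is left over. *)
pose eta := (b - I) / 3; have eta0 : 0 < eta by rewrite divr_gt0// subr_gt0.
pose n := (Num.bound eta^-1).+1.
have n_gt0 : 0 < n%:R :> R by rewrite ltr0n.
have n_eta : n%:R^-1 <= eta.
  rewrite invf_ple ?posrE// ltW// (lt_le_trans (archi_boundP _))//.
    by rewrite invr_ge0 ltW.
  by rewrite ler_nat.
pose F (i : 'I_n) := [set x | i.+1%:R <= n%:R * h x].
have cF i : closed (F i).
  rewrite (_ : F i = h @^-1` [set y | i.+1%:R / n%:R <= y]).
    by move/continuous_closedP : ch; apply; exact: closed_ge.
  by apply/seteqP; split => x /=; rewrite /F/= ler_pdivrMr// mulrC.
have mF i : measurable (F i : set borel) by exact: closed_measurable.
have FE i x : \1_(F i) x = (i.+1%:R <= n%:R * h x)%R%:R :> R.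
  by rewrite indicE mem_setE.
have muF i : mu (F i) = (fine (mu (F i)))%:E.
  by rewrite fineK// fin_num_measure.
have sum_mu : \sum_(i < n) fine (mu (F i)) <= n%:R * I.
  rewrite -lee_fin -sumEFin EFinM -IE -ge0_integralZl_EFin//; first last.
  - exact/measurable_EFinP.
  - by move=> x _; rewrite lee_fin.
  under eq_bigr do rewrite -muF -[F _]setIT -integral_indic//.
  rewrite -ge0_integral_sum//; first last.
  - by move=> i; apply/measurable_EFinP; exact: measurable_indic.
  apply: ge0_le_integral => //.
  - by move=> x _; apply: sume_ge0 => i _; rewrite lee_fin.
  - by apply: emeasurable_sum => i; apply/measurable_EFinP; exact: measurable_indic.
  - by apply/measurable_EFinP; apply: measurable_funM.
  - move=> x _; rewrite sumEFin -EFinM lee_fin.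
    under eq_bigr do rewrite FE.
    by apply: floor_sum_le; rewrite mulr_ge0.
have visitsF : \forall N \near \oo, forall (i : 'I_n) x,
    visits (F i) N x <= (fine (mu (F i)) + eta) * N%:R.
  apply: filter_forall => i; apply: closed_average => //.
  by rewrite muF lte_fin ltrDl.
apply: filterS visitsF => N vN x.
rewrite -(ler_pM2l n_gt0) mulr_sumr.
rewrite (@le_trans _ _ (\sum_(1 <= k < N.+1) (1 + \sum_(i < n) \1_(F i) (iter k T x))))//.
  apply: ler_sum => k _; rewrite -lerBlDl.
  under eq_bigr do rewrite FE.
  apply: floor_sum_ge; rewrite ler_piMr//.
  by have /andP[] := h01 (iter k T x).
rewrite big_split/= sumr_const_nat subn1/= exchange_big/=.
rewrite (@le_trans _ _ (N%:R + \sum_(i < n) (fine (mu (F i)) + eta) * N%:R))//.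
  by rewrite lerD2l; apply: ler_sum => i _; exact: vN.
rewrite -mulr_suml big_split/= sumr_const card_ord -mulr_natl.
have E : b = I + 3 * eta by rewrite /eta; field.
have n_eta' : 1 <= n%:R * eta by rewrite -ler_pdivrMl// mulr1.
have N0 : 0 <= N%:R :> R by [].
rewrite E; move: N0 n_eta' sum_mu; clear.
set s := \sum_(_ < _) _; move: (N%:R) => t t0 H1 H2.
have P1 : 0 <= t * (n%:R * I - s) by rewrite mulr_ge0// subr_ge0.
have P2 : 0 <= t * (n%:R * eta - 1) by rewrite mulr_ge0// subr_ge0.
lra.
Qed.

Lemma continuous_average (g : X -> R) (b : R) : continuous g -> \int[mu]_x g x < b ->
  \forall N \near \oo, forall x, \sum_(1 <= n < N.+1) g (iter n T x) <= b * N%:R.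
Proof.
move=> cg gb.
have [C C0 gC] := continuous_bounded cg.
(* This affine change brings the values into [[0, 1]]; as [mu] has mass one, integrals and averages
   change alike. *)
pose h x := (2 * C)^-1 * (g x + C).
have C2 : 0 < 2 * C by rewrite mulr_gt0.
have ch : continuous h.
  by move=> x; apply: cvgMl_tmp; apply: cvgD; [exact: cg|exact: cvg_cst].
have ig := continuous_integrable cg.
have ic : mu.-integrable [set: borel] (EFin \o cst C).
  exact: finite_measure_integrable_cst.
have hE : \int[mu]_x h x = (2 * C)^-1 * (\int[mu]_x g x + C).
  rewrite /h RintegralZl//; last first.
    by have := integrableD measurableT ig ic; apply: eq_integrable.
  rewrite RintegralD// Rintegral_cst//.
  have mu1 : fine (mu [set: borel]) = 1 by rewrite probability_setT.
  by congr (_ * (_ + _)); rewrite -[RHS]mulr1 -[in RHS]mu1.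
have hb : \int[mu]_x h x < (2 * C)^-1 * (b + C).
  by rewrite hE ltr_pM2l ?invr_gt0// ltrD2r.
have h01 x : 0 <= h x <= 1.
  have := gC x; rewrite ler_norml => /andP[g1 g2].
  rewrite /h mulr_ge0 ?invr_ge0 ?(ltW C2)//=; last lra.
  by rewrite ler_pdivrMl//; lra.
apply: filterS (unit_average ch h01 hb) => N + x => /(_ x).
rewrite /h -mulr_sumr -mulrA ler_pM2l ?invr_gt0// big_split/=.
by rewrite sumr_const_nat subn1/= mulrDl -(mulr_natr C) lerD2r.
Qed.

End uniform_averages.

(** * From real to complex averages *)

Section complex_averages.
Context {R : realType} {d : measure_display} {X : measurableType d}.
Variables (mu : probability X R) (T : X -> X) (S : set X).

(** One-sided, as the maximal inequality and the bound on closed sets provide it; used for [g] and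
    [- g] together, it gives convergence. *)
Definition upper_average (g : X -> R) := forall b : R, \int[mu]_x g x < b ->
  \forall N \near \oo, forall x, S x -> \sum_(1 <= n < N.+1) g (iter n T x) <= b * N%:R.

Lemma Rintegral_opp (g : X -> R) : mu.-integrable [set: X] (EFin \o g) ->
  \int[mu]_x (- g x) = - (\int[mu]_x g x).
Proof.
move=> ig; rewrite -mulN1r -RintegralZl//.
by apply: eq_Rintegral => x _; rewrite mulN1r.
Qed.

Lemma upper_average_dist (g : X -> R) (eta : R) :
  mu.-integrable [set: X] (EFin \o g) -> upper_average g ->
  upper_average (fun x => - g x) -> 0 < eta ->
  \forall N \near \oo, forall x, S x ->
    `|\sum_(1 <= n < N.+1) g (iter n T x) - (\int[mu]_x g x) * N%:R| <= eta * N%:R.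
Proof.
move=> ig ug uNg eta0.
have u1 : \int[mu]_x g x < \int[mu]_x g x + eta by rewrite ltrDl.
have u2 : \int[mu]_x (- g x) < - (\int[mu]_x g x) + eta by rewrite Rintegral_opp// ltrDl.
near=> N => x Sx.
have H1 : forall x, S x ->
    \sum_(1 <= n < N.+1) g (iter n T x) <= (\int[mu]_x g x + eta) * N%:R.
  by near: N; exact: ug.
have H2 : forall x, S x ->
    \sum_(1 <= n < N.+1) - g (iter n T x) <= (- (\int[mu]_x g x) + eta) * N%:R.
  by near: N; exact: uNg.
have {}H1 := H1 _ Sx; have {}H2 := H2 _ Sx; rewrite sumrN in H2.
by rewrite ler_norml; apply/andP; split; lra.
Unshelve. all: by end_near. Qed.

Lemma complex_average (f : X -> R[i]) (B : R) :
  mu.-integrable [set: X] (EFin \o (fun x => complex.Re (f x))) ->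
  mu.-integrable [set: X] (EFin \o (fun x => complex.Im (f x))) ->
  upper_average (fun x => complex.Re (f x)) ->
  upper_average (fun x => - complex.Re (f x)) ->
  upper_average (fun x => complex.Im (f x)) ->
  upper_average (fun x => - complex.Im (f x)) ->
  normc (complex_integral mu f) < B ->
  \forall N \near \oo, forall x, S x ->
    normc (\sum_(1 <= n < N.+1) f (iter n T x)) <= B * N%:R.
Proof.
move=> iR iI uR uNR uI uNI fB.
set I := complex_integral mu f in fB.
pose eta := (B - normc I) / 2.
have eta0 : 0 < eta by rewrite divr_gt0// subr_gt0.
have ReE N x : complex.Re (\sum_(1 <= n < N.+1) f (iter n T x)) =
    \sum_(1 <= n < N.+1) complex.Re (f (iter n T x)) by rewrite raddf_sum.
have ImE N x : complex.Im (\sum_(1 <= n < N.+1) f (iter n T x)) =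
    \sum_(1 <= n < N.+1) complex.Im (f (iter n T x)) by rewrite raddf_sum.
apply: filterS2 (upper_average_dist iR uR uNR eta0) (upper_average_dist iI uI uNI eta0).
move=> N HR HI x Sx.
rewrite (le_trans (normc_sub_le _ (I * (N%:R : R)%:C%C)))//.
rewrite normcM normc_real ger0_norm//.
have -> : B = normc I + (eta + eta) by rewrite /eta; field.
rewrite [leRHS]mulrDl lerD2l (le_trans (normc_le_ReIm _))// mulrDl lerD//.
  by rewrite raddfB/= ReE mulr0 subr0; exact: HR.
by rewrite raddfB/= ImE mulr0 add0r; exact: HI.
Qed.

End complex_averages.

Lemma lee_real {R : realType} (l a : \bar R) : (0 <= a)%E ->
  (forall B : R, (a < B%:E)%E -> (l <= B%:E)%E) -> (l <= a)%E.
Proof.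
case: a => [a| |] // _ lB; last exact: leey.
by apply/lee_addgt0Pr => eps eps0; rewrite -EFinD; apply: lB; rewrite lte_fin ltrDl.
Qed.

Lemma weighted_average_le {R : realType} {X : Type} (T : X -> X) (f : X -> R[i])
    (p : R -> R) (N : nat) (x : X) (B : R) : (0 < N)%N ->
  normc (\sum_(1 <= n < N.+1) e (p n%:R) * f (iter n T x)) <= B * N%:R ->
  normc (weighted_average T f p N x) <= B.
Proof.
move=> N0 H; rewrite /weighted_average normcM normcV normc_nat.
by rewrite ler_pdivrMl ?ltr0n// mulrC.
Qed.

(** * Null sets and essentially bounded functions *)

Section almost_everywhere.
Context {R : realType} {d : measure_display} {X : measurableType d}.
Variables (mu : probability X R) (T : X -> X).

Lemma ae_forall_count (I : countType) (P : I -> X -> Prop) :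
  (forall i, {ae mu, forall x, P i x}) -> {ae mu, forall x, forall i, P i x}.
Proof.
move=> aP.
have : {ae mu, forall x, forall n, if unpickle n is Some i then P i x else True}.
  apply: ae_foralln => n; case: unpickle => [i|]; first exact: aP.
  exact: aeW.
by apply: filterS => x Px i; have := Px (pickle i); rewrite pickleK.
Qed.

Hypothesis Tmu : measure_preserving mu T.

Lemma ae_preserving (P : X -> Prop) : {ae mu, forall x, P x} ->
  {ae mu, forall x, P (T x)}.
Proof.
move=> [N [mN N0 PN]]; exists (T @^-1` N); split.
- by rewrite -[X in measurable X]setTI; exact: Tmu.1.
- exact: etrans (Tmu.2 _ mN) N0.
- by move=> x /= nP; exact: PN.
Qed.

Lemma ae_preserving_iter (P : X -> Prop) n : {ae mu, forall x, P x} ->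
  {ae mu, forall x, P (iter n T x)}.
Proof.
elim: n => [//|n ih] /ih /ae_preserving; apply: filterS => x.
by rewrite -iterSr.
Qed.

(** An explicit almost everywhere bound, for which stability under the recursion of the seminorms is
    a direct computation. *)
Definition complex_bounded (f : X -> R[i]) :=
  [/\ measurable_fun [set: X] (fun x => complex.Re (f x)),
      measurable_fun [set: X] (fun x => complex.Im (f x)) &
      exists C, {ae mu, forall x, normc (f x) <= C}].

Lemma Lfun_ae_bounded (g : X -> R) : g \in Lfun mu +oo%E ->
  exists C, {ae mu, forall x, `|g x| <= C}.
Proof.
move=> /sub_Lfun_finLfun; rewrite inE /finite_norm unlock.
have -> : (0 < mu [set: X])%E by rewrite probability_setT.
move=> /= gy; have := ess_sup_ge mu (abse \o (EFin \o g)).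
move: gy; case: (ess_sup _ _) => [r _ H| |_ H]; last 2 first.
- by rewrite ltxx.
- by exists 0; apply: filterS H => x; rewrite leeNy_eq.
by exists r; apply: filterS H => x; rewrite lee_fin.
Qed.

Lemma complex_Linfty_bounded (f : X -> R[i]) : complex_Linfty mu f -> complex_bounded f.
Proof.
move=> [fR fI]; split.
- by have := sub_Lfun_mfun fR; rewrite inE.
- by have := sub_Lfun_mfun fI; rewrite inE.
- have [C1 H1] := Lfun_ae_bounded fR; have [C2 H2] := Lfun_ae_bounded fI.
  exists (C1 + C2); apply: filterS2 H1 H2 => x h1 h2.
  by rewrite (le_trans (normc_le_ReIm _))// lerD.
Qed.

Lemma complex_bounded_conj (f : X -> R[i]) h : complex_bounded f ->
  complex_bounded (fun x => f (iter h T x) * (f x)^*%C).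
Proof.
move=> [mR mI [C fC]].
have mTR := measurableT_comp mR (measurable_iter h Tmu.1).
have mTI := measurableT_comp mI (measurable_iter h Tmu.1).
split.
- rewrite (_ : (fun x => _) = (fun x => complex.Re (f (iter h T x)) * complex.Re (f x) +
     complex.Im (f (iter h T x)) * complex.Im (f x))).
    by apply: measurable_funD; exact: measurable_funM.
  by apply/funext => x; case: (f _) => a b; case: (f x) => a' b' /=; ring.
- rewrite (_ : (fun x => _) = (fun x => complex.Im (f (iter h T x)) * complex.Re (f x) -
     complex.Re (f (iter h T x)) * complex.Im (f x))).
    by apply: measurable_funB; exact: measurable_funM.
  by apply/funext => x; case: (f _) => a b; case: (f x) => a' b' /=; ring.
- exists (C * C); apply: filterS2 (ae_preserving_iter h fC) fC => x h1 h2.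
  by rewrite normcM normc_conj ler_pM ?normc_ge0.
Qed.

Lemma ae_bounded_integrable (g : X -> R) (C : R) : measurable_fun [set: X] g ->
  {ae mu, forall x, `|g x| <= C} -> mu.-integrable [set: X] (EFin \o g).
Proof.
move=> mg gC; apply/integrableP; split; first exact/measurable_EFinP.
apply: (@le_lt_trans _ _ (\int[mu]_x (cst (`|C|%:E) x))%E).
  apply: ae_ge0_le_integral => //.
    by apply: measurableT_comp => //; exact/measurable_EFinP.
    by move=> x _; rewrite lee_fin.
  by apply: filterS gC => x gx _; rewrite lee_fin (le_trans gx)// ler_norm.
rewrite integral_cst//.
have -> : ((mu : {measure set X -> \bar R}) [set: X] = 1)%E by exact: probability_setT.
by rewrite mule1 ltry.
Qed.

End almost_everywhere.

(** * The pointwise bound in ergodic systems *)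

Section pointwise.
Context {R : realType} {d : measure_display} {X : measurableType d}.
Variables (mu : probability X R) (T : X -> X).
Hypothesis Terg : ergodic mu T.

(** The thresholds exceeding the integral by [k.+1%:R^-1] suffice for every [b], so one null set
    serves all [b]. *)
Lemma ae_upper_average (g : X -> R) : mu.-integrable [set: X] (EFin \o g) ->
  {ae mu, forall x, upper_average mu T [set x] g}.
Proof.
move=> ig.
have : {ae mu, forall x, forall k, \forall N \near \oo,
    \sum_(1 <= n < N.+1) g (iter n T x) <= (\int[mu]_x g x + k.+1%:R^-1) * N%:R}.
  apply: ae_foralln => k; apply: birkhoff_upper => //.
  by rewrite ltrDl invr_gt0.
apply: filterS => x gx b gb.
have bg : 0 < b - \int[mu]_x g x by rewrite subr_gt0.
apply: filterS (gx (Num.bound (b - \int[mu]_x g x)^-1)) => N H y ->.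
rewrite (le_trans H)// ler_wpM2r// addrC -lerBrDr.
rewrite invf_ple ?posrE// (@le_trans _ _ (Num.bound (b - \int[mu]_x g x)^-1)%:R) ?ler_nat//.
by rewrite ltW// archi_boundP// invr_ge0 ltW.
Qed.

(* The functions reached from [f] by the recursion that defines the seminorms.
   They are countably many, so that a single null set serves them all. *)
Fixpoint derived (f : X -> R[i]) (l : seq nat) : X -> R[i] :=
  if l is h :: l' then fun x => derived f l' (iter h T x) * (derived f l' x)^*%C
  else f.

Lemma derived_bounded f l : complex_bounded mu f -> complex_bounded mu (derived f l).
Proof.
by move=> bf; elim: l => //= h l ih; apply: complex_bounded_conj => //; exact: Terg.1.
Qed.

Lemma ae_complex_average (f : X -> R[i]) : complex_bounded mu f ->
  {ae mu, forall x, forall B, normc (complex_integral mu f) < B ->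
    \forall N \near \oo, forall y, [set x] y ->
      normc (\sum_(1 <= n < N.+1) f (iter n T y)) <= B * N%:R}.
Proof.
move=> [mR mI [C fC]].
have iR : mu.-integrable [set: X] (EFin \o (fun x => complex.Re (f x))).
  apply: (ae_bounded_integrable mR (C := C)); apply: filterS fC => x; apply: le_trans.
  by case: (f x) => a b /=; rewrite -sqrtr_sqr ler_wsqrtr// lerDl sqr_ge0.
have iI : mu.-integrable [set: X] (EFin \o (fun x => complex.Im (f x))).
  apply: (ae_bounded_integrable mI (C := C)); apply: filterS fC => x; apply: le_trans.
  by case: (f x) => a b /=; rewrite -sqrtr_sqr ler_wsqrtr// lerDr sqr_ge0.
have iNR : mu.-integrable [set: X] (EFin \o (fun x => - complex.Re (f x))).
  by have := integrableN iR; apply: eq_integrable.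
have iNI : mu.-integrable [set: X] (EFin \o (fun x => - complex.Im (f x))).
  by have := integrableN iI; apply: eq_integrable.
have Im_avg : {ae mu, forall x,
    upper_average mu T [set x] (fun x => complex.Im (f x)) /\
    upper_average mu T [set x] (fun x => - complex.Im (f x))}.
  by apply: filterS2 (ae_upper_average iI) (ae_upper_average iNI) => x; split.
apply: filterS3 (ae_upper_average iR) (ae_upper_average iNR) Im_avg => x uR uNR [uI uNI] B fB.
exact: complex_average fB.
Qed.

(** Almost every orbit is bounded under [f] and has the right averages for all derived functions; at
    such a point the deterministic [twisted_average] applies with [S] reduced to that point. *)
Lemma pointwise_twisted (delta M : R) (m : nat) (f : X -> R[i]) :
  0 < delta -> 0 < M -> complex_Linfty mu f ->
  {ae mu, forall x,
    (limn_esup (fun N : nat =>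
       ereal_sup [set (normc (weighted_average T f p N x))%:E
                 | p in class_L delta M m])
     <= uniformity_seminorm mu T m.+1 f)%E}.
Proof.
move=> delta0 M0 /complex_Linfty_bounded bf; have [_ _ [C fC]] := bf.
have orbit : {ae mu, forall x, forall n, normc (f (iter n T x)) <= C}.
  by apply: ae_foralln => n; apply: (ae_preserving_iter Terg.1 (P := fun x => normc (f x) <= C)).
have avg : {ae mu, forall x, forall (l : seq nat) B,
    normc (complex_integral mu (derived f l)) < B ->
    \forall N \near \oo, forall y, [set x] y ->
      normc (\sum_(1 <= n < N.+1) derived f l (iter n T y)) <= B * N%:R}.
  by apply: ae_forall_count => l; apply: ae_complex_average; exact: derived_bounded.
apply: filterS2 orbit avg => x xC xavg.
apply: lee_real; first exact: uniformity_seminorm_ge0.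
move=> B fB; apply: limn_esup_le.
have := @twisted_average R d X mu T [set x] (range (derived f)) _ _ _ m f
  (fun n => 2 ^+ m * M * n%:R `^ (- delta)) B _ _ fB.
case.
(* Each derivation squares the bound along the orbit. *)
- move=> _ [l _ <-]; elim: l => [|h l [D lD]]; first by exists C => _ n ->; exact: xC.
  exists (D * D) => y n Sy; rewrite /= normcM normc_conj ler_pM ?normc_ge0//.
    by rewrite -iterD; exact: lD.
  exact: lD.
- by move=> _ h [l _ <-]; exists (h :: l).
- by move=> _ b [l _ <-]; exact: xavg.
- by exists [::].
- exact: cvg_fdiff_bound.
(* Starting at [N0.+1] excludes [N = 0], so that the division by [N] is legitimate. *)
move=> N0 _ N0B; exists N0.+1 => // N /= N0N; apply: ge_ereal_sup => _ [p pL <-].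
rewrite lee_fin; apply: weighted_average_le; first exact: leq_trans N0N.
apply: (N0B N (ltnW N0N) (fun n => p n%:R)) => //.
exact: class_L_fdiff_le.
Qed.

End pointwise.

(** * The uniform bound in uniquely ergodic systems *)

Section uniform.
Context {R : realType} {X : pmetricType R}.
Local Notation borel := (g_sigma_algebraType (@open X)).
Variables (mu : probability borel R) (T : X -> X).
Hypotheses (cptX : compact [set: X]) (T_continuous : continuous T)
  (mu_unique : unique_invariant_probability mu T).

Definition complex_continuous (f : X -> R[i]) :=
  continuous (fun x => complex.Re (f x)) /\ continuous (fun x => complex.Im (f x)).

Lemma continuous_complex (f : X -> R[i]) : continuous (f : X -> R[i]^o) ->
  complex_continuous f.
Proof.
move=> cf; split=> x; apply/cvgrPdist_le => eps eps0.
  have /cvgrPdist_le /(_ (eps%:C)%C) := cf x.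
  rewrite ltcR => /(_ eps0); apply: filterS => t.
  rewrite -raddfB => H; rewrite -lecR (le_trans _ H)//.
  exact: normc_ge_Re.
have /cvgrPdist_le /(_ (eps%:C)%C) := cf x.
rewrite ltcR => /(_ eps0); apply: filterS => t.
rewrite -raddfB => H; rewrite -lecR (le_trans _ H)//.
case: (_ - _) => a b; rewrite normc_def lecR /=.
by rewrite -sqrtr_sqr ler_wsqrtr// lerDr sqr_ge0.
Qed.

Lemma continuous_iter n : continuous (iter n T).
Proof.
elim: n => [|n ih] x; first exact: cvg_id.
by apply: (@continuous_comp _ _ _ (iter n T) T); [exact: ih|exact: T_continuous].
Qed.

Lemma complex_continuous_conj (f : X -> R[i]) h : complex_continuous f ->
  complex_continuous (fun x => f (iter h T x) * (f x)^*%C).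
Proof.
move=> [cR cI].
have cTR x : {for x, continuous (fun x => complex.Re (f (iter h T x)))}.
  by apply: (@continuous_comp _ _ _ (iter h T) (fun x => complex.Re (f x)));
    [exact: continuous_iter|exact: cR].
have cTI x : {for x, continuous (fun x => complex.Im (f (iter h T x)))}.
  by apply: (@continuous_comp _ _ _ (iter h T) (fun x => complex.Im (f x)));
    [exact: continuous_iter|exact: cI].
split.
- rewrite (_ : (fun x => _) = (fun x => complex.Re (f (iter h T x)) * complex.Re (f x) +
     complex.Im (f (iter h T x)) * complex.Im (f x))).
    move=> x; apply: cvgD; apply: cvgM; [exact: cTR|exact: cR|exact: cTI|exact: cI].
  by apply/funext => x; case: (f _) => a b; case: (f x) => a' b' /=; ring.
- rewrite (_ : (fun x => _) = (fun x => complex.Im (f (iter h T x)) * complex.Re (f x) -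
     complex.Re (f (iter h T x)) * complex.Im (f x))).
    move=> x; apply: cvgB; apply: cvgM; [exact: cTI|exact: cR|exact: cTR|exact: cI].
  by apply/funext => x; case: (f _) => a b; case: (f x) => a' b' /=; ring.
Qed.

(** With [S] the whole space, one threshold for [N] serves all points, which permits the supremum
    norm. *)
Lemma uniform_twisted (delta M : R) (m : nat) (f : X -> R[i]) :
  0 < delta -> 0 < M -> continuous (f : X -> R[i]^o) ->
  (limn_esup (fun N : nat =>
     ereal_sup [set sup_norm (weighted_average T f p N) | p in class_L delta M m])
   <= uniformity_seminorm mu T m.+1 f)%E.
Proof.
move=> delta0 M0 /continuous_complex cf.
apply: lee_real; first exact: uniformity_seminorm_ge0.
move=> B fB; apply: limn_esup_le.
have := @twisted_average R _ borel mu T setT complex_continuous _ _ _ m f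
  (fun n => 2 ^+ m * M * n%:R `^ (- delta)) B _ _ fB.
case => //.
- move=> g [cR cI].
  have [C1 _ g1] := continuous_bounded cptX cR.
  have [C2 _ g2] := continuous_bounded cptX cI.
  by exists (C1 + C2) => x n _; rewrite (le_trans (normc_le_ReIm _))// lerD.
- by move=> g h; exact: complex_continuous_conj.
- move=> g b [cR cI] gb.
  have upper (k : X -> R) : continuous k -> upper_average mu T [set: borel] k.
    move=> ck c kc; have := continuous_average cptX T_continuous mu_unique ck kc.
    by apply: filterS => N H x _; exact: H.
  have cNR : continuous (fun x => - complex.Re (g x)) by move=> x; apply: cvgN; exact: cR.
  have cNI : continuous (fun x => - complex.Im (g x)) by move=> x; apply: cvgN; exact: cI.
  apply: (@complex_average R _ borel mu T setT) => //.
  + exact: continuous_integrable.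
  + exact: continuous_integrable.
  + exact: upper.
  + exact: upper.
  + exact: upper.
  + exact: upper.
- exact: cvg_fdiff_bound.
move=> N0 _ N0B; exists N0.+1 => // N /= N0N; apply: ge_ereal_sup => _ [p pL <-].
apply: ge_ereal_sup => _ [x _ <-].
rewrite lee_fin; apply: weighted_average_le; first exact: leq_trans N0N.
apply: (N0B N (ltnW N0N) (fun n => p n%:R)) => //.
exact: class_L_fdiff_le.
Qed.

End uniform.

Theorem theorem2p11 (R : realType) (m : nat) (delta M : R)
    (delta_gt0 : 0 < delta) (M_gt0 : 0 < M) :
  (forall (d : measure_display) (X : measurableType d)
      (mu : probability X R) (T : X -> X),
    ergodic mu T ->
    forall f : X -> R[i], complex_Linfty mu f ->
    {ae mu, forall x,
      (limn_esup (fun N : nat =>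
         ereal_sup [set (normc (weighted_average T f p N x))%:E
                   | p in class_L delta M m])
       <= uniformity_seminorm mu T m.+1 f)%E})
  /\
  (forall (X : pmetricType R)
      (mu : probability (g_sigma_algebraType (@open X)) R) (T : X -> X),
    compact [set: X] -> continuous T ->
    unique_invariant_probability mu T ->
    forall f : X -> R[i], continuous (f : X -> R[i]^o) ->
      (limn_esup (fun N : nat =>
         ereal_sup [set sup_norm (weighted_average T f p N)
                   | p in class_L delta M m])
       <= uniformity_seminorm mu T m.+1 f)%E).
Proof.
split.
  move=> d X mu T Terg f fL; exact: pointwise_twisted.
move=> X mu T cptX cT muT f cf; exact: uniform_twisted.
Qed.
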